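(* Let $\xi:\mathbb{R}^{D\times D}\to\mathbb{R}$ be smooth and strictly convex on $S^D_+$. For every $1$-Lipschitz and pre-concave function $\varphi:\mathcal P^\uparrow_\xi\to\mathbb{R}$, the function $\bar\varphi:\mathcal M_1(\mathcal K_\xi)\to\mathbb{R}$ is a $1$-Lipschitz and concave extension of $\varphi$. In addition, for every $\mu'\in\mathcal M_1(\mathcal K_\xi)$, \[\bar\varphi(\mu')=\min_{\chi\in\mathcal L_{\le1}(\mathcal K_\xi)}\Big\{\int\chi\,\mathrm d\mu'-\varphi^\xi_*(\chi)\Big\}.\]
   Context: $S^D$: symmetric $D\times D$ matrices with Frobenius product and norm $|\cdot|$; $S^D_+$: positive semidefinite cone; $B(0,1)$: closed unit ball of $S^D$; $\nabla\xi$: Frobenius gradient. $\mathcal K_\xi=\nabla\xi(B(0,1)\cap S^D_+)$, $x_0=\nabla\xi(0)$. $U$ is uniform on $[0,1)$; $\mathcal P^\uparrow_\xi=\{\mathrm{Law}(\nabla\xi(\mathsf q(U))):\mathsf q:[0,1)\to S^D_+$ right-continuous with left limits, nondecreasing ($\mathsf q(v)-\mathsf q(u)\in S^D_+$ for $u\le v$), $|\mathsf q(u)|\le1$ for all $u\}$. $\mathcal L(\mathcal K_\xi)$: Lipschitz functions $\chi:\mathcal K_\xi\to\mathbb{R}$ with norm $|\chi|_{\mathcal L}=\max\{|\chi(x_0)|,|\chi|_{\mathrm{Lip}}\}$; $\mathcal L_{\le1}(\mathcal K_\xi)$ its closed unit ball. For signed Borel measures $\nu$ on $\mathcal K_\xi$,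 $|\nu|_{\mathcal M}=\sup_{\chi\in\mathcal L_{\le1}(\mathcal K_\xi)}\int\chi\,\mathrm d\nu$; $\mathcal M_1(\mathcal K_\xi)$ is the completion for this norm, $d(\nu,\nu')=|\nu-\nu'|_{\mathcal M}$ (on probability measures this is the $1$-Wasserstein distance), and $\mu\mapsto\int\chi\,\mathrm d\mu$ extends continuously for $\chi\in\mathcal L(\mathcal K_\xi)$. $\varphi$ is pre-concave if for all $\mu,\nu\in\mathcal P^\uparrow_\xi$, $\lambda\in[0,1]$ with $\lambda\mu+(1-\lambda)\nu\in\mathcal P^\uparrow_\xi$: $\lambda\varphi(\mu)+(1-\lambda)\varphi(\nu)\le\varphi(\lambda\mu+(1-\lambda)\nu)$. For $\eta$ a Borel probability measure on $(\mathcal P^\uparrow_\xi,d)$, $\mathrm{Bar}(\eta)$ is the probability measure $A\mapsto\int\nu(A)\,\mathrm d\eta(\nu)$. For continuous $\varphi$: $\bar\varphi(\mu')=\sup_{\eta\in\mathcal P(\mathcal P^\uparrow_\xi)}\{\int\varphi\,\mathrm d\eta-d(\mathrm{Bar}(\eta),\mu')\}$ and $\varphi^\xi_*(\chi)=\inf_{\mu\in\mathcal P^\uparrow_\xi}\{\int\chi\,\mathrm d\mu-\varphi(\mu)\}$. *)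

(* Defs.v *)
From HB Require Import structures.
From mathcomp Require Import all_boot all_order all_algebra.
From mathcomp Require Import all_classical all_reals all_analysis.
Set Implicit Arguments. Unset Strict Implicit. Unset Printing Implicit Defensive.
Import Order.TTheory GRing.Theory Num.Theory.
Local Open Scope ring_scope.
Local Open Scope classical_set_scope.

Section Defs.
Variables (R : realType) (D : nat).

Definition Mat := 'M[R]_D.
HB.instance Definition _ := Choice.on Mat.
HB.instance Definition _ := isPointed.Build Mat (0 : 'M[R]_D).

Definition frob (A : 'M[R]_D) : R :=
  Num.sqrt (\sum_(i < D) \sum_(j < D) (A i j) ^+ 2).

Definition frob_open (A : set Mat) : Prop :=
  forall x, A x -> exists e : R, 0 < e /\ forall y, frob (y - x) < e -> A y.

Local Notation BMat := (g_sigma_algebraType frob_open).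

Definition psd (A : 'M[R]_D) : Prop :=
  A^T = A /\ forall x : 'cV[R]_D, 0 <= (x^T *m A *m x) 0 0.

Definition dirD (v : 'M[R]_D) (g : 'M[R]_D -> R) : 'M[R]_D -> R :=
  fun x => derive (fun t : R => g (x + t *: v)) 0 1.

Definition iterD (vs : seq 'M[R]_D) (g : 'M[R]_D -> R) : 'M[R]_D -> R :=
  foldr dirD g vs.

Definition frob_continuous (g : 'M[R]_D -> R) : Prop :=
  forall x (e : R), 0 < e -> exists d : R, 0 < d /\
    forall y, frob (y - x) < d -> `|g y - g x| < e.

Definition smooth (xi : 'M[R]_D -> R) : Prop :=
  forall (vs : seq 'M[R]_D),
    frob_continuous (iterD vs xi) /\
    forall v x, derivable (fun t : R => iterD vs xi (x + t *: v)) 0 1.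

Definition strictly_convex_psd (xi : 'M[R]_D -> R) : Prop :=
  forall A B (t : R), psd A -> psd B -> A != B -> 0 < t < 1 ->
    xi (t *: A + (1 - t) *: B) < t * xi A + (1 - t) * xi B.

Definition grad (xi : 'M[R]_D -> R) (A : 'M[R]_D) : 'M[R]_D :=
  \matrix_(i < D, j < D) dirD (delta_mx i j) xi A.

Variable xi : 'M[R]_D -> R.

Definition Kxi : set Mat := [set grad xi A | A in [set A | psd A /\ frob A <= 1]].
Definition x0 : 'M[R]_D := grad xi 0.

Definition lipK (chi : Mat -> R) (L : R) : Prop :=
  forall x y, Kxi x -> Kxi y -> `|chi x - chi y| <= L * frob (x - y).

(* closed unit ball of L(K_xi): max(|chi(x0)|, |chi|_Lip) <= 1 *)
Definition Lle1 (chi : Mat -> R) : Prop := `|chi x0| <= 1 /\ lipK chi 1.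

(* Borel measures on K_xi are represented as Borel measures on R^{DxD}
   carried by K_xi. *)
Definition Prob := probability BMat R.
Definition ProbPoint : Prob := @dirac _ BMat (0 : Mat) R.
HB.instance Definition _ := gen_eqMixin Prob.
HB.instance Definition _ := gen_choiceMixin Prob.
HB.instance Definition _ := isPointed.Build Prob ProbPoint.

Definition on_K (mu : {measure set BMat -> \bar R}) : Prop := mu (~` Kxi) = 0%E.

Definition intK (mu : {measure set BMat -> \bar R}) (chi : Mat -> R) : R :=
  fine (\int[mu]_(x in Kxi) (chi x)%:E).

Record signed := Signed {
  spos : {finite_measure set BMat -> \bar R};
  sneg : {finite_measure set BMat -> \bar R} }.

Definition signed_on_K (nu : signed) : Prop := on_K (spos nu) /\ on_K (sneg nu).

Definition intS (nu : signed) (chi : Mat -> R) : R :=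
  intK (spos nu) chi - intK (sneg nu) chi.

(* The completion of the signed measures for |.|_M is realised as the
   closure of their image in the space of functions on L_{<=1}(K_xi) with the
   sup norm (isometric embedding nu |-> (chi |-> int chi dnu)).  An element
   mu' of M_1 is given by F with F chi = "int chi dmu'". *)
Definition inM1 (F : (Mat -> R) -> R) : Prop :=
  forall e : R, 0 < e -> exists nu : signed, signed_on_K nu /\
    forall chi, Lle1 chi -> `|F chi - intS nu chi| <= e.

Definition embed (mu : Prob) : (Mat -> R) -> R := fun chi => intK mu chi.

Definition distM (F G : (Mat -> R) -> R) : R :=
  sup [set r | exists chi, Lle1 chi /\ r = F chi - G chi].

(* d on probability measures (1-Wasserstein) *)
Definition dP (mu nu : Prob) : R := distM (embed mu) (embed nu).

Definition Pup (mu : Prob) : Prop :=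
  exists q : R -> 'M[R]_D,
    (forall u, 0 <= u < 1 -> psd (q u) /\ frob (q u) <= 1) /\
    (forall u v, 0 <= u -> u <= v -> v < 1 -> psd (q v - q u)) /\
    (forall u, 0 <= u < 1 -> forall e : R, 0 < e -> exists d : R, 0 < d /\
        forall v, u <= v < 1 -> v < u + d -> frob (q v - q u) < e) /\
    (forall u, 0 < u < 1 -> exists L : 'M[R]_D, forall e : R, 0 < e ->
        exists d : R, 0 < d /\ forall v, 0 <= v < u -> u - d < v ->
          frob (q v - L) < e) /\
    (forall A : set BMat, measurable A ->
        mu A = lebesgue_measure [set u : R | 0 <= u < 1 /\ A (grad xi (q u))]).

Definition Pup_open (A : set Prob) : Prop :=
  A `<=` Pup /\ forall mu, A mu -> exists e : R, 0 < e /\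
     forall nu, Pup nu -> dP mu nu < e -> A nu.

(* Borel sets of (P^up, d), viewed inside the type of all probabilities *)
Local Notation BProb := (g_sigma_algebraType Pup_open).

Definition evalP (nu : Prob) (A : set BMat) : \bar R := nu A.

Definition eta_on_Pup (eta : probability BProb R) : Prop := eta (~` Pup) = 0%E.

Definition is_Bar (eta : probability BProb R) (beta : Prob) : Prop :=
  forall A : set BMat, measurable A ->
    beta A = (\int[eta]_(nu in (Pup : set BProb)) evalP nu A)%E.

Definition intP (eta : probability BProb R) (f : Prob -> R) : R :=
  fine (\int[eta]_(nu in (Pup : set BProb)) (f nu)%:E).

Definition phibar_set (phi : Prob -> R) (F : (Mat -> R) -> R) : set R :=
  [set r | exists (eta : probability BProb R) (beta : Prob),
     eta_on_Pup eta /\ is_Bar eta beta /\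
     r = intP eta phi - distM (embed beta) F].

Definition phibar (phi : Prob -> R) (F : (Mat -> R) -> R) : R :=
  sup (phibar_set phi F).

Definition phistar (phi : Prob -> R) (chi : Mat -> R) : R :=
  inf [set r | exists mu, Pup mu /\ r = intK mu chi - phi mu].

Definition lip1_Pup (phi : Prob -> R) : Prop :=
  forall mu nu, Pup mu -> Pup nu -> `|phi mu - phi nu| <= dP mu nu.

Definition preconcave (phi : Prob -> R) : Prop :=
  forall (mu nu rho : Prob) (l : R), Pup mu -> Pup nu -> 0 <= l <= 1 ->
    (forall A : set BMat, measurable A ->
        rho A = (l%:E * mu A + (1 - l)%:E * nu A)%E) ->
    Pup rho ->
    l * phi mu + (1 - l) * phi nu <= phi rho.

End Defs.

(* Main.v *)
Require Import Defs.
From HB Require Import structures.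
From mathcomp Require Import all_boot all_order all_algebra perm.
From mathcomp Require Import all_classical all_reals all_analysis.
From mathcomp Require Import measurable_realfun giry.
From mathcomp Require Import ring lra zify.
Set Implicit Arguments. Unset Strict Implicit. Unset Printing Implicit Defensive.
Import Order.TTheory GRing.Theory Num.Theory.
Import numFieldNormedType.Exports.
Local Open Scope ring_scope.
Local Open Scope classical_set_scope.

(* Let eta be a law on P^up with barycenter beta, and mu in P^up. Transporting
   beta onto mu optimally moves each nu in the support of eta to a law nu' carried
   by the chain supporting mu, and the mean of the nu' is mu. Every law carried by a
   chain lies in P^up, so pre-concavity applies to the nu' and gives
   int phi d eta <= phi(mu) + d(beta, mu). After quantization of the monotone
   paths, uniformly over P^up, all laws are averages of N Dirac masses and the
   optimal transport is a permutation, with a Kantorovich potential as dual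
   solution. The min formula follows from a finite minimax theorem on a net of the
   Lipschitz unit ball, compactness giving the minimizer; the Lipschitz, concavity
   and extension properties are read off it. *)

(** Pre-concavity says nothing about a general family in [Pup], whose mixtures usually leave [Pup];
    only laws carried by one common chain can be mixed freely. This is why a family is first pushed
    onto the chain of [mu]. Up to quantization nothing is lost: each member pays at most the cost of
    its own share of the transport, because [phi] is 1-Lipschitz, and the shares add up to the
    optimal cost, which a single potential bounds by the distance from the barycenter to [mu].
    Transport and Jensen's inequality are needed for finite uniform averages only. An arbitrary
    [eta] enters through weak duality alone, where the pointwise bound by [phistar] is integrated.
    The reverse inequality is reached by finite averages, since the minimax theorem returns a list
    with repetitions. Hence no transport plan has to be chosen measurably. Apart from the symmetry
    of the distance, an element of the completion is used only through its boundedness, affinity and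
    uniform continuity on the Lipschitz ball. *)

(** * Frobenius norm and positive semidefinite matrices *)

Section Frobenius.
Variables (R : realType) (D : nat).
Implicit Types (A B C : 'M[R]_D).

(** Lagrange's identity: twice the defect in the Cauchy-Schwarz inequality is the sum of the squares
    of all [a i * b j - a j * b i]. *)
Lemma sum_mul_sq (I : finType) (a b : I -> R) :
  (\sum_i a i * b i) ^+ 2 <= (\sum_i a i ^+ 2) * (\sum_i b i ^+ 2).
Proof.
have H : 0 <= \sum_i \sum_j (a i * b j - a j * b i) ^+ 2.
  by apply: sumr_ge0 => i _; apply: sumr_ge0 => j _; apply: sqr_ge0.
suff E : \sum_i \sum_j (a i * b j - a j * b i) ^+ 2 =
    2 * ((\sum_i a i ^+ 2) * (\sum_i b i ^+ 2) - (\sum_i a i * b i) ^+ 2).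
  by move: H; rewrite E; lra.
transitivity (\sum_i \sum_j (a i ^+ 2 * b j ^+ 2 + a j ^+ 2 * b i ^+ 2
    - 2 * ((a i * b i) * (a j * b j)))).
  by apply: eq_bigr => i _; apply: eq_bigr => j _; ring.
under eq_bigr => i _ do rewrite sumrB big_split /= -mulr_sumr -mulr_suml -mulr_sumr -mulr_sumr.
by rewrite sumrB big_split /= -mulr_suml -mulr_sumr -mulr_sumr -mulr_suml; ring.
Qed.

Lemma frobE A : frob A = Num.sqrt (\sum_(p : 'I_D * 'I_D) A p.1 p.2 ^+ 2).
Proof. by rewrite /frob pair_big. Qed.

Lemma frob_ge0 A : 0 <= frob A.
Proof. exact: sqrtr_ge0. Qed.

Lemma frob_sq A : frob A ^+ 2 = \sum_(p : 'I_D * 'I_D) A p.1 p.2 ^+ 2.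
Proof. by rewrite frobE sqr_sqrtr// sumr_ge0// => p _; exact: sqr_ge0. Qed.

Lemma frob_eqsq A B : (forall i j, A i j ^+ 2 = B i j ^+ 2) -> frob A = frob B.
Proof. by move=> AB; rewrite !frobE; congr Num.sqrt; apply: eq_bigr. Qed.

Lemma frob0 : frob (0 : 'M[R]_D) = 0.
Proof. by rewrite frobE big1 ?sqrtr0// => p _; rewrite mxE expr0n. Qed.

Lemma frobN A : frob (- A) = frob A.
Proof. by apply: frob_eqsq => i j; rewrite mxE sqrrN. Qed.

Lemma frobC A B : frob (A - B) = frob (B - A).
Proof. by rewrite -frobN opprB. Qed.

Lemma frobZ (t : R) A : frob (t *: A) = `|t| * frob A.
Proof.
rewrite !frobE -sqrtr_sqr -sqrtrM ?sqr_ge0// mulr_sumr.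
by congr Num.sqrt; apply: eq_bigr => p _; rewrite mxE exprMn.
Qed.

Lemma frobD A B : frob (A + B) <= frob A + frob B.
Proof.
rewrite -(@ler_pXn2r _ 2)// ?nnegrE ?addr_ge0 ?frob_ge0//.
have H := @sum_mul_sq ('I_D * 'I_D)%type (fun p => A p.1 p.2) (fun p => B p.1 p.2).
rewrite -!frob_sq -exprMn in H.
have {}H : \sum_(p : 'I_D * 'I_D) A p.1 p.2 * B p.1 p.2 <= frob A * frob B.
  apply: le_trans (ler_norm _) _.
  rewrite -(@ler_pXn2r _ 2)// ?nnegrE ?mulr_ge0 ?frob_ge0//.
  by rewrite real_normK// num_real.
rewrite sqrrD !frob_sq.
have -> : \sum_(p : 'I_D * 'I_D) (A + B) p.1 p.2 ^+ 2 =
   \sum_(p : 'I_D * 'I_D) A p.1 p.2 ^+ 2 + \sum_(p : 'I_D * 'I_D) B p.1 p.2 ^+ 2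
   + 2 * \sum_(p : 'I_D * 'I_D) A p.1 p.2 * B p.1 p.2.
  by rewrite mulr_sumr -!big_split /=; apply: eq_bigr => p _; rewrite mxE; ring.
lra.
Qed.

Lemma frobB_trans A B C : frob (A - C) <= frob (A - B) + frob (B - C).
Proof. by apply: le_trans (frobD _ _); rewrite addrA subrK. Qed.

Lemma ler_frob_dist A B : `|frob A - frob B| <= frob (A - B).
Proof.
have h1 := frobD (A - B) B; have h2 := frobD (B - A) A.
rewrite !subrK in h1 h2; rewrite (frobC B A) in h2.
by rewrite ler_norml; apply/andP; split; lra.
Qed.

Lemma entry_le_frob A i j : `|A i j| <= frob A.
Proof.
rewrite -(@ler_pXn2r _ 2)// ?nnegrE ?frob_ge0// real_normK ?num_real// frob_sq.
rewrite (bigD1 (i, j))//= lerDl sumr_ge0// => p _; exact: sqr_ge0.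
Qed.

Lemma frob_le_sum A : frob A <= \sum_i \sum_j `|A i j|.
Proof.
suff H (I : finType) (F : I -> 'M[R]_D) : frob (\sum_i F i) <= \sum_i frob (F i).
  rewrite [in leLHS](matrix_sum_delta A).
  apply: le_trans (H _ _) _; apply: ler_sum => i _.
  apply: le_trans (H _ _) _; apply: ler_sum => j _.
  rewrite frobZ -[leRHS]mulr1 ler_wpM2l//.
  rewrite frobE -sqrtr1 ler_wsqrtr// (bigD1 (i, j))//= mxE !eqxx expr1n.
  rewrite big1 ?addr0// => -[k l]; rewrite xpair_eqE mxE /=.
  by move=> /negbTE ->; rewrite expr0n.
elim/big_ind2 : _ => //; first by rewrite frob0.
by move=> x y z t xy zt; apply: le_trans (frobD _ _) _; apply: lerD.
Qed.

Lemma frob_le_entries A (e : R) : (forall i j, `|A i j| <= e) -> frob A <= (D ^ 2)%:R * e.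
Proof.
move=> Ae; apply: le_trans (frob_le_sum _) _.
apply: le_trans (_ : \sum_(i < D) \sum_(j < D) e <= _).
  by apply: ler_sum => i _; apply: ler_sum.
rewrite big_const_ord iter_addr_0 big_const_ord iter_addr_0 -mulrnA.
by rewrite mulr_natl mulnn.
Qed.

Lemma frob_eq0 A : frob A <= 0 -> A = 0.
Proof.
move=> A0; apply/matrixP => i j; rewrite mxE; apply/eqP; rewrite -normr_le0.
exact: le_trans (entry_le_frob _ _ _) A0.
Qed.

Lemma qformE A (x : 'cV[R]_D) :
  (x^T *m A *m x) 0 0 = \sum_i \sum_j x i 0 * A i j * x j 0.
Proof.
rewrite mxE exchange_big /=; apply: eq_bigr => j _.
by rewrite mxE mulr_suml; apply: eq_bigr => i _; rewrite mxE.
Qed.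

Lemma psd0 : psd (0 : 'M[R]_D).
Proof. by split; [rewrite trmx0|move=> x; rewrite mulmx0 mul0mx mxE]. Qed.

(** Polarization: [s = 0] exhibits a diagonal entry, while [s = 1] and [s = -1] together bound an
    off-diagonal entry by the mean of two diagonal ones. *)
Lemma qform2 A (i j : 'I_D) (s : R) : A^T = A ->
  ((delta_mx i 0 + s *: delta_mx j 0)^T *m A *m (delta_mx i 0 + s *: delta_mx j 0)
    : 'M[R]_1) 0 0 = A i i + 2 * s * A i j + s ^+ 2 * A j j.
Proof.
move=> tA.
have -> : (delta_mx i 0 + s *: delta_mx j 0)^T =
    delta_mx 0 i + s *: delta_mx 0 j :> 'rV[R]_D.
  by apply/matrixP => k l; rewrite !mxE; congr (_%:R + _ * _%:R); rewrite andbC.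
rewrite !mulmxDl !mulmxDr.
rewrite -!(scalemxAl, scalemxAr) -!rowE -!colE !mxE.
have -> : A j i = A i j by rewrite -{1}tA mxE.
by ring.
Qed.

Lemma psd_diag_ge0 A i : psd A -> 0 <= A i i.
Proof.
move=> [tA pA]; have := pA (delta_mx i 0 + 0 *: delta_mx i 0).
by rewrite qform2// mulr0 mul0r addr0 expr0n mul0r addr0.
Qed.

Lemma psd_entry_le_tr A i j : psd A -> `|A i j| <= \tr A.
Proof.
move=> psdA; have [tA pA] := psdA.
have d k : 0 <= A k k by apply: psd_diag_ge0.
have h1 := pA (delta_mx i 0 + 1 *: delta_mx j 0).
have h2 := pA (delta_mx i 0 + (-1) *: delta_mx j 0).
rewrite !qform2// in h1 h2.
have hi k : A k k <= \tr A.
  by rewrite /mxtrace (bigD1 k)//= lerDl sumr_ge0.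
have := hi i; have := hi j; rewrite ler_norml => ? ?; apply/andP; split; lra.
Qed.

(** On the cone the norm is dominated by a linear functional, so the norms of the increments of a
    monotone path can be summed by telescoping. *)
Lemma psd_frob_le_tr A : psd A -> frob A <= (D ^ 2)%:R * \tr A.
Proof. by move=> pA; apply: frob_le_entries => i j; exact: psd_entry_le_tr. Qed.

Lemma tr_le_frob A : \tr A <= D%:R * frob A.
Proof.
apply: le_trans (_ : \sum_(i < D) frob A <= _).
  by apply: ler_sum => i _; apply: le_trans (ler_norm _) (entry_le_frob _ _ _).
by rewrite big_const_ord iter_addr_0 mulr_natl.
Qed.

Lemma psd_tr_ge0 A : psd A -> 0 <= \tr A.
Proof. by move=> pA; apply: sumr_ge0 => i _; exact: psd_diag_ge0. Qed.

End Frobenius.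

(* McShane's formula; it yields Lipschitz extensions, Kantorovich potentials and,
   for [a = 0], distance functions. *)
Section InfConvolution.
Variables (R : realType) (D : nat) (I : Type) (y : I -> 'M[R]_D) (a : I -> R).
Hypothesis lbd : forall z, exists b, forall i, b <= a i + frob (z - y i).
Hypothesis inhab : inhabited I.

Definition infconv (z : Mat R D) : R := inf (range (fun i => a i + frob (z - y i))).

Let hinf z : has_inf (range (fun i => a i + frob (z - y i))).
Proof.
split; first by case: inhab => i; exists (a i + frob (z - y i)); exists i.
by have [b bP] := lbd z; exists b => _ [i _ <-].
Qed.

Lemma infconv_le z i : infconv z <= a i + frob (z - y i).
Proof. by apply: ge_inf; [have [] := hinf z|exists i]. Qed.

Lemma infconv_ge z b : (forall i, b <= a i + frob (z - y i)) -> b <= infconv z.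
Proof.
move=> bP; apply: lb_le_inf; first by have [] := hinf z.
by move=> _ [i _ <-].
Qed.

Lemma infconv_lip z z' : `|infconv z - infconv z'| <= frob (z - z').
Proof.
have H u v : infconv u <= infconv v + frob (u - v).
  rewrite -lerBlDr; apply: infconv_ge => i; rewrite lerBlDr.
  apply: le_trans (infconv_le _ i) _; rewrite -addrA lerD2l addrC.
  exact: frobB_trans.
have := H z z'; have := H z' z; rewrite (frobC z') ler_norml => ? ?.
by apply/andP; split; lra.
Qed.

End InfConvolution.

(** * Optimal assignment and cyclic monotonicity *)

Section Assignment.
Variables (R : realType) (J : finType).
Implicit Types (w c : J -> J -> R).

Fixpoint walk w (x : J) (s : seq J) : R :=
  if s is y :: s' then w x y + walk w y s' else 0.

Lemma walk_cat w x s1 s2 : walk w x (s1 ++ s2) = walk w x s1 + walk w (last x s1) s2.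
Proof.
elim: s1 x => [|y s1 IH] x /=; first by rewrite add0r.
by rewrite IH addrA.
Qed.

Lemma walk_nth w x s :
  walk w x s = \sum_(k < size s) w (nth x (x :: s) k) (nth x s k).
Proof.
elim: s x => [|y s IH] x /=; first by rewrite big_ord0.
rewrite big_ord_recl /= IH; congr (_ + _); apply: eq_bigr => k _.
rewrite /bump /= !add0n/=; congr (w _ _); last by apply: set_nth_default; exact: ltn_ord.
by apply: set_nth_default; rewrite /= ltnS ltnW// ltn_ord.
Qed.

Variable w : J -> J -> R.
Hypothesis w0 : forall x, w x x = 0.
Hypothesis wperm : forall s : {perm J}, 0 <= \sum_x w x (s x).

(** A cycle without repeated vertices is the permutation [next], extended by the identity; the fixed
    points contribute nothing by [w0]. *)
Lemma uniq_walk_ge0 x s : uniq (x :: s) -> 0 <= walk w x (rcons s x).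
Proof.
move=> us.
have inj : injective (next (x :: s)) by apply: can_inj (prev_next us).
have := wperm (perm inj).
rewrite (bigID (mem (x :: s))) /= [X in _ + X]big1 ?addr0; last first.
  by move=> i; rewrite permE next_nth => /negbTE ->; exact: w0.
rewrite -big_uniq// (big_nth x) big_mkord /= walk_nth size_rcons.
congr (_ <= _); apply: eq_bigr => k _.
have k_lt : (k < size (x :: s))%N by exact: ltn_ord.
rewrite permE next_nth mem_nth// index_uniq//.
have -> : nth x (x :: rcons s x) k = nth x (x :: s) k.
  by rewrite -rcons_cons nth_rcons k_lt.
congr (w _ _); rewrite nth_rcons; case: ltnP => // h.
by rewrite nth_default//; case: eqP.
Qed.

(** A closed walk that visits a vertex twice splits there into two shorter closed walks, down to the
    simple cycles. *)
Lemma closed_walk_ge0 x s : 0 <= walk w x (rcons s x).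
Proof.
have [n] := ubnP (size s); elim: n => // n IH in x s *; rewrite ltnS => sn.
have [us|] := boolP (uniq (x :: s)); first exact: uniq_walk_ge0.
rewrite cons_uniq negb_and negbK => /orP[xs|].
  case/splitPr: xs sn => s1 s2; rewrite size_cat /= => sn.
  rewrite rcons_cat /= -cat_rcons walk_cat last_rcons addr_ge0// IH//.
    lia.
  lia.
move=> nus.
have [y [s1 [s2 [s3 E]]]] : exists y s1 s2 s3, s = s1 ++ y :: s2 ++ y :: s3.
  elim: s nus {sn} => // y s IHs; rewrite cons_uniq negb_and negbK.
  case/orP => [/splitPr[p1 p2]|/IHs[z [s1 [s2 [s3 ->]]]]].
    by exists y, [::], p1, p2.
  by exists z, (y :: s1), s2, s3.
have -> : walk w x (rcons s x) =
    walk w x (rcons (s1 ++ y :: s3) x) + walk w y (rcons s2 y).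
  rewrite E !rcons_cat /= !walk_cat /= !rcons_cat /= -[in LHS]cat_rcons.
  by rewrite walk_cat last_rcons; ring.
rewrite E size_cat /= size_cat /= in sn.
rewrite addr_ge0// IH// ?size_cat /=; lia.
Qed.

(** Shortest walks: [a j] is the infimum of the weights of all walks from [j]. It is finite because
    one further edge closes a walk, and closed walks have non-negative weight. *)
Lemma potential : exists a : J -> R, forall j k, a j <= w j k + a k.
Proof.
pose a j := inf (range (walk w j)).
have hinf j : has_inf (range (walk w j)).
  split; first by exists (walk w j [::]); exists [::].
  exists (- \sum_x \sum_y `|w x y|) => _ [s _ <-].
  have := closed_walk_ge0 j s; rewrite -cats1 walk_cat /= addr0 => h.
  rewrite lerNl; apply: le_trans (_ : w (last j s) j <= _); first by lra.
  apply: le_trans (ler_norm _) _.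
  rewrite (bigD1 (last j s))//= (bigD1 j)//= -addrA lerDl addr_ge0//.
    by rewrite sumr_ge0.
  by rewrite sumr_ge0// => i _; rewrite sumr_ge0.
exists a => j k; rewrite -lerBlDl; apply: lb_le_inf; first by have [] := hinf k.
move=> _ [s _ <-]; rewrite lerBlDl; apply: ge_inf; first by have [] := hinf j.
by exists (k :: s).
Qed.

End Assignment.

(* Duality for the optimal assignment problem: an optimal permutation is
   cyclically monotone, hence carried by the graph of a Kantorovich potential. *)
Lemma assignment_duality (R : realType) (D : nat) (J : finType) (j0 : J)
    (x y : J -> 'M[R]_D) :
  exists (chi : Mat R D -> R) (s : {perm J}),
    (forall u v, `|chi u - chi v| <= frob (u - v)) /\
    \sum_j frob (x j - y (s j)) <= \sum_j chi (x j) - \sum_j chi (y j).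
Proof.
pose cost (s : {perm J}) := \sum_j frob (x j - y (s j)).
have [s smin] : exists s, forall s', cost s <= cost s'.
  by case: (@arg_minP _ _ _ (1%g : {perm J}) xpredT cost) => // s _ h; exists s => s'; exact: h.
(* The extra cost when [x j] takes over the target of [x k]. Summed along a permutation [t], it
   compares the assignment [t * s] with the optimal [s]. *)
pose w j k := frob (x j - y (s k)) - frob (x j - y (s j)).
have [a aP] : exists a : J -> R, forall j k, a j <= w j k + a k.
  apply: potential; first by move=> j; exact: subrr.
  move=> t; rewrite sumrB subr_ge0.
  apply: le_trans (smin (t * s)%g) _; rewrite /cost.
  by under eq_bigr do rewrite permM.
have lbd z : exists b, forall i, b <= a i + frob (z - y (s i)).
  exists (- \sum_i `|a i|) => i; rewrite lerNl opprD.
  apply: le_trans (_ : `|a i| <= _).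
    have := ler_norm (- a i); rewrite normrN; have := frob_ge0 (z - y (s i)); lra.
  by rewrite (bigD1 i)//= lerDl sumr_ge0.
exists (infconv (y \o s) a), s; split; first by move=> u v; apply: infconv_lip => //; exact: inhabits j0.
rewrite (reindex_inj (h := s) perm_inj (F := fun j => infconv (y \o s) a (y j)))/=.
rewrite -sumrB; apply: ler_sum => j _.
have h1 : infconv (y \o s) a (y (s j)) <= a j.
  by have := @infconv_le _ _ _ (y \o s) a lbd (inhabits j0) (y (s j)) j; rewrite /= subrr frob0 addr0.
have h2 : a j + frob (x j - y (s j)) <= infconv (y \o s) a (x j).
  apply: infconv_ge => [//||k]; first exact: inhabits j0.
  by have := aP j k; rewrite /w /=; lra.
lra.
Qed.

(** * Finite nets and cluster points *)

(** Points with equal integer parts of [(v x i + C) / e] for all [i] are [e]-close, and there are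
    finitely many such codes. One point is kept per code that occurs, so the net lies inside [X]. *)
Lemma finite_net (R : realType) (T : Type) (I : finType) (X : set T)
    (v : T -> I -> R) (C e : R) : 0 < e ->
  (forall x i, X x -> `|v x i| <= C) ->
  exists (n : nat) (s : 'I_n -> T), (forall k, X (s k)) /\
    forall x, X x -> exists k, forall i, `|v x i - v (s k) i| <= e.
Proof.
move=> e0 vC.
pose r x i : nat := `|Num.floor ((v x i + C) / e)|%N.
pose N := `|Num.floor ((C + C) / e)|%N.+1.
have rN x i : X x -> (r x i < N)%N.
  move=> Xx; have := vC x i Xx; rewrite ler_norml => /andP[h1 h2].
  have C0 : 0 <= v x i + C by lra.
  rewrite /N ltnS -lez_nat /r !gez0_abs ?floor_ge0 ?divr_ge0 ?(ltW e0)//; last lra.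
  by apply: le_floor; rewrite ler_pM2r ?invr_gt0//; lra.
have rclose x y i : X x -> X y -> r x i = r y i -> `|v x i - v y i| <= e.
  move=> Xx Xy; rewrite /r => E.
  have := vC x i Xx; rewrite ler_norml => /andP[hx1 hx2].
  have := vC y i Xy; rewrite ler_norml => /andP[hy1 hy2].
  have {}E : Num.floor ((v x i + C) / e) = Num.floor ((v y i + C) / e).
    by rewrite -[LHS]gez0_abs ?E ?gez0_abs// floor_ge0 divr_ge0 ?(ltW e0)//; lra.
  have A1 := floor_le_tmp ((v x i + C) / e); have A2 := floorD1_gt ((v x i + C) / e).
  have B1 := floor_le_tmp ((v y i + C) / e); have B2 := floorD1_gt ((v y i + C) / e).
  rewrite E in A1 A2.
  have h : `|(v x i + C) / e - (v y i + C) / e| <= 1.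
    rewrite intrD in A2 B2; rewrite ler_norml; apply/andP; split; lra.
  rewrite -mulrBl normrM [`|e^-1|]gtr0_norm ?invr_gt0// ler_pdivrMr// mul1r in h.
  by move: h; rewrite opprD addrACA subrr addr0.
pose code x : {ffun I -> 'I_N} := [ffun i => inord (r x i)].
have [X0|nX0] := pselect (exists x, X x); last first.
  have f : 'I_0 -> T by case.
  by exists 0%N, f; split; [case|move=> x Xx; case: nX0; exists x].
have [x0 Xx0] := X0.
pose g f := if pselect (exists x, X x /\ code x = f) is left h then projT1 (cid h) else x0.
have gP x : X x -> X (g (code x)) /\ code (g (code x)) = code x.
  move=> Xx; rewrite /g; case: pselect => [h|[]]; first by case: cid.
  by exists x.
have gX f : X (g f) by rewrite /g; case: pselect => // h; case: cid => ? [].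
exists #|{ffun I -> 'I_N}|, (fun k => g (enum_val k)); split; first by move=> k; exact: gX.
move=> x Xx; exists (enum_rank (code x)) => i; rewrite enum_rankK.
have [Xg /ffunP/(_ i)] := gP x Xx; rewrite !ffunE => E.
apply: rclose => //; apply/esym.
by move/(congr1 val): E; rewrite /= !inordK ?rN.
Qed.

(** Tychonoff's theorem. [I] may be uncountable, so only a cluster point is obtained, and a
    neighbourhood in the product topology controls finitely many coordinates [s] at a time. *)
Lemma cluster_point (R : realType) (I : choiceType) (u : nat -> I -> R) (C : R) :
  (forall n i, `|u n i| <= C) ->
  exists f : I -> R, forall (s : seq I) (e : R) (N : nat), 0 < e ->
    exists2 n, (N <= n)%N & forall i, i \in s -> `|u n i - f i| < e.
Proof.
move=> uC.
have cpt : @compact (prod_topology (fun=> R : topologicalType))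
    [set f : I -> R | forall i, `[- C, C]%classic (f i)].
  by apply: (@tychonoff I (fun=> R) (fun=> `[- C, C]%classic)) => i; exact: segment_compact.
have FA : ((u : nat -> prod_topology (fun=> R : topologicalType)) @ \oo)
    [set f : I -> R | forall i, `[- C, C]%classic (f i)].
  by exists 0%N => // n _ i; rewrite /= in_itv /= -ler_norml.
have [f [_ fcl]] := cpt _ (fmap_proper_filter _ _) FA.
exists f => s e N e0.
have H : nbhs (f : prod_topology (fun=> R : topologicalType))
    [set g | forall i, i \in s -> `|g i - f i| < e].
  have FF := @nbhs_filter (prod_topology (fun=> R : topologicalType)) f.
  elim: s => [|j s IH].
    rewrite (_ : [set g | _] = setT); first exact: (@filterT _ _ FF).
    by apply/seteqP; split.
  have Hj : nbhs (f : prod_topology (fun=> R : topologicalType)) [set g | `|g j - f j| < e].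
    have := @proj_continuous I (fun=> R : topologicalType) j f.
    move=> /(_ [set r | `|r - f j| < e]); apply.
    by apply/nbhs_ballP; exists e => //= r; rewrite /ball /= distrC.
  apply: (@filterS _ _ FF) (@filterI _ _ FF _ _ Hj IH) => g [gj gs] i.
  rewrite inE => /orP[/eqP ->//|].
  exact: gs.
have FN : ((u : nat -> prod_topology (fun=> R : topologicalType)) @ \oo)
    [set u n | n in [set n | (N <= n)%N]].
  by exists N => // n /= Nn; exists n.
have [_ [[n /= Nn <-] h]] := fcl _ _ FN H.
by exists n.
Qed.

(* A finite minimax theorem; the optimal mixture is realised as an average over
   a list with repetitions, i.e. with rational weights. *)
Section Minimax.
Variables (R : realType) (T : Type) (I : eqType) (comb : R -> T -> T -> T).
Variables (g : I -> T -> R) (B : R).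

Definition comb_closed (X : set T) :=
  forall t x y, 0 <= t <= 1 -> X x -> X y -> X (comb t x y).

(** The image of [X] under [(h, k)] is convex and misses the quadrant [h <= 0], [k <= 0], so a line
    through the origin with non-negative normal separates them. For a normal [(m, 1)], [m] must lie
    between the ratios [- k y / h y] where [k y < 0] and the ratios [k x / - h x] where [h x < 0];
    the supremum of the former is taken. *)
Lemma two_minimax (X : set T) (h k : T -> R) : comb_closed X ->
  (forall t x y, 0 <= t <= 1 -> X x -> X y -> h (comb t x y) = t * h x + (1 - t) * h y) ->
  (forall t x y, 0 <= t <= 1 -> X x -> X y -> k (comb t x y) = t * k x + (1 - t) * k y) ->
  (forall x, X x -> 0 < h x \/ 0 < k x) ->
  exists2 t, 0 <= t <= 1 & forall x, X x -> 0 <= t * h x + (1 - t) * k x.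
Proof.
move=> cX hA kA hk.
have [[p [Xp hp]]|noh] := pselect (exists p, X p /\ h p < 0); last first.
  exists 1; first by rewrite ler01 lexx.
  move=> x Xx; rewrite subrr mul0r addr0 mul1r leNgt; apply/negP => hx; apply: noh.
  by exists x.
have [[q [Xq kq]]|nok] := pselect (exists q, X q /\ k q < 0); last first.
  exists 0; first by rewrite ler01 lexx.
  move=> x Xx; rewrite mul0r add0r subr0 mul1r leNgt; apply/negP => hx; apply: nok.
  by exists x.
(* At the mixture of [x] and [y] where [h] vanishes, [k] must be positive; this compares the two
   kinds of ratios, with denominators cleared. *)
have key x y : X x -> X y -> h x < 0 -> k y < 0 -> h x * k y <= h y * k x.
  move=> Xx Xy hx ky.
  have kx : 0 < k x by case: (hk x Xx) => //; lra.
  have hy : 0 < h y by case: (hk y Xy) => //; lra.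
  pose t := h y / (h y - h x).
  have d0 : 0 < h y - h x by lra.
  have t01 : 0 <= t <= 1.
    by rewrite divr_ge0 ?(ltW hy) ?(ltW d0)//= ler_pdivrMr//; lra.
  have ht : h (comb t x y) = 0.
    by rewrite hA// /t; field; lra.
  have := hk _ (cX _ _ _ t01 Xx Xy); rewrite ht ltxx => -[//|].
  rewrite kA// => h0.
  have : 0 < (h y - h x) * (t * k x + (1 - t) * k y) by apply: mulr_gt0.
  have -> : (h y - h x) * (t * k x + (1 - t) * k y) = h y * k x - h x * k y.
    by rewrite /t; field; lra.
  lra.
pose S := [set r | exists y, [/\ X y, k y < 0 & r = - k y / h y]].
have hpos y : X y -> k y < 0 -> 0 < h y by move=> Xy ky; case: (hk y Xy) => //; lra.
have kpos x : X x -> h x < 0 -> 0 < k x by move=> Xx hx; case: (hk x Xx) => //; lra.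
have ubS x : X x -> h x < 0 -> ubound S (k x / - h x).
  move=> Xx hx _ [y [Xy ky ->]].
  rewrite ler_pdivrMr ?hpos// mulrAC ler_pdivlMr; last lra.
  by have := key x y Xx Xy hx ky; lra.
have S0 : S !=set0 by exists (- k q / h q), q.
have hS : has_sup S by split=> //; exists (k p / - h p); exact: ubS.
pose m := sup S.
have m0 : 0 < m.
  apply: lt_le_trans (_ : - k q / h q <= m).
    by rewrite divr_gt0 ?hpos// oppr_gt0.
  by apply: ub_le_sup; [case: hS|exists q].
have m1 : 0 < m + 1 by lra.
have mh x : X x -> 0 <= m * h x + k x.
  move=> Xx; have [hx|hx] := ltP (h x) 0.
    have : m <= k x / - h x by apply: ge_sup => //; exact: ubS.
    by rewrite ler_pdivlMr; lra.
  have [kx|kx] := ltP (k x) 0; last by rewrite addr_ge0// mulr_ge0// ltW.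
  have : - k x / h x <= m by apply: ub_le_sup; [case: hS|exists x].
  by rewrite ler_pdivrMr ?hpos//; lra.
exists (m / (m + 1)).
  by rewrite divr_ge0 ?(ltW m0) ?(ltW m1)//= ler_pdivrMr//; lra.
move=> x Xx; have -> : m / (m + 1) * h x + (1 - m / (m + 1)) * k x =
    (m * h x + k x) / (m + 1) by field; lra.
by rewrite divr_ge0 ?mh// ltW.
Qed.

(** Induction on [s]. The head [j] serves the points where [g j] reaches [c]; the rest of [s] serves
    the convex set of the others through an averaged list, and [two_minimax] merges that list with
    [j]. *)
Lemma list_minimax (s : seq I) (X : set T) (c : R) : comb_closed X ->
  (forall i t x y, 0 <= t <= 1 -> X x -> X y ->
     g i (comb t x y) = t * g i x + (1 - t) * g i y) ->
  (forall i x, X x -> `|g i x| <= B) ->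
  (forall x, X x -> exists2 i, i \in s & c <= g i x) ->
  (exists x, X x) ->
  forall e, 0 < e -> exists2 l : seq I, (0 < size l)%N &
    forall x, X x -> (c - e) * (size l)%:R <= \sum_(i <- l) g i x.
Proof.
elim: s => [|j s IH] in X c *.
  by move=> _ _ _ H [x /H[i]]; rewrite in_nil.
move=> cX gA gB H [x0 Xx0] e e0.
pose Y := [set x | X x /\ g j x < c].
have [[y0 Yy0]|noY] := pselect (exists x, Y x); last first.
  exists [:: j] => // x Xx; rewrite big_seq1 mulr1.
  have [h|h] := ltP (g j x) c; last lra.
  by case: noY; exists x.
have cY : comb_closed Y.
  move=> t x y t01 [Xx xc] [Xy yc]; split; first exact: cX.
  rewrite gA//; case/andP: t01 => t0 t1.
  have [->|tn0] := eqVneq t 0; first by lra.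
  have : 0 < t by rewrite lt_neqAle eq_sym tn0.
  move=> tp; have : t * g j x < t * c by rewrite ltr_pM2l.
  have : (1 - t) * g j y <= (1 - t) * c by apply: ler_wpM2l; lra.
  lra.
have e4 : 0 < e / 4 by lra.
have [||||l l0 lP] := IH Y c cY _ _ _ _ (e / 4) e4.
- by move=> i t x y t01 [Xx _] [Xy _]; exact: gA.
- by move=> i x [Xx _]; exact: gB.
- move=> x [Xx xc]; have [i] := H x Xx; rewrite inE => /orP[/eqP ->|is_]; first lra.
  by exists i.
- by exists y0.
have sl : 0 < (size l)%:R :> R by rewrite ltr0n.
(* Lowering both thresholds to [c - e / 2] yields the strict alternative that [two_minimax]
   requires; the other half of [e] pays for a rational weight. *)
pose h x := (size l)%:R^-1 * \sum_(i <- l) g i x - (c - e / 2).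
pose k x := g j x - (c - e / 2).
have [|||t t01 tP] := @two_minimax X h k cX.
- move=> t x y t01 Xx Xy; rewrite /h.
  rewrite (eq_bigr (fun i => t * g i x + (1 - t) * g i y)); last by move=> i _; exact: gA.
  by rewrite big_split /= -!mulr_sumr; ring.
- by move=> t x y t01 Xx Xy; rewrite /k gA//; ring.
- move=> x Xx; have [xc|xc] := ltP (g j x) c; last by right; rewrite /k; lra.
  left; rewrite /h subr_gt0.
  have := lP x (conj Xx xc); rewrite -ler_pdivlMr// mulrC => hl; lra.
have B0 : 0 <= B by apply: le_trans (gB j x0 Xx0).
case/andP: (t01) => t0 t1.
(* [t] is replaced by the rational [p / (m + 1)]. *)
have [m mP] : exists m : nat, 2 * B / m.+1%:R <= e / 2.
  exists (Num.truncn (4 * B / e)); rewrite ler_pdivrMr ?ltr0Sn//.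
  have := truncnS_gt (4 * B / e); rewrite ltr_pdivrMr//; lra.
pose p := Num.truncn (t * m.+1%:R).
have tm0 : 0 <= t * m.+1%:R by rewrite mulr_ge0.
have p1 : p%:R <= t * m.+1%:R by rewrite -truncn_ge_nat.
have p2 : t * m.+1%:R < p%:R + 1.
  by rewrite natr1; exact: truncnS_gt.
have pm : (p <= m.+1)%N.
  by rewrite -(@ler_nat R); apply: le_trans p1 _; rewrite ler_piMl.
(* [j] is repeated in blocks of [size l], so that the list [l] gets the weight [p / m.+1] and [j]
   the complementary one. *)
exists (flatten (nseq p l) ++ nseq ((m.+1 - p) * size l) j).
  rewrite size_cat size_nseq size_flatten /shape map_nseq sumn_nseq mulnC.
  by rewrite -mulnDl subnKC// muln_gt0 l0.
move=> x Xx.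
have -> : \sum_(i <- flatten (nseq p l) ++ nseq ((m.+1 - p) * size l) j) g i x =
    p%:R * \sum_(i <- l) g i x + (m.+1%:R - p%:R) * (size l)%:R * g j x.
  rewrite big_cat /= big_flatten /= big_nseq iter_addr_0 big_nseq iter_addr_0.
  by rewrite -[_ *+ p]mulr_natl -[_ *+ (_ * _)]mulr_natl natrM natrB.
have -> : (size (flatten (nseq p l) ++ nseq ((m.+1 - p) * size l) j))%:R =
    m.+1%:R * (size l)%:R :> R.
  rewrite size_cat size_nseq size_flatten /shape map_nseq sumn_nseq mulnC.
  by rewrite -mulnDl subnKC// natrM.
have := tP x Xx; rewrite /h /k.
set S := \sum_(i <- l) g i x; set n := (size l)%:R; set M := m.+1%:R => hS.
have M0 : 0 < M by rewrite ltr0Sn.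
have SB : `|n^-1 * S| <= B.
  rewrite normrM gtr0_norm ?invr_gt0// ler_pdivrMl// mulrC.
  apply: le_trans (ler_norm_sum _ _ _) _.
  apply: le_trans (ler_sum _ (fun i _ => gB i x Xx)) _.
  by rewrite big_const_seq count_predT iter_addr_0 mulr_natr.
have jB := gB j x Xx.
set a := n^-1 * S in hS SB.
have Sa : S = n * a by rewrite /a mulrA divff ?mul1r// gt_eqF.
rewrite Sa.
have -> : p%:R * (n * a) + (M - p%:R) * n * g j x = n * (p%:R * a + (M - p%:R) * g j x) by ring.
have -> : (c - e) * (M * n) = n * ((c - e) * M) by ring.
rewrite ler_pM2l//.
have d : `|p%:R - t * M| <= 1 by rewrite ler_norml; apply/andP; split; lra.
have d2 : `|(p%:R - t * M) * (a - g j x)| <= 2 * B.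
  rewrite normrM -[leRHS]mul1r; apply: ler_pM => //.
  by apply: le_trans (ler_normB _ _) _; lra.
have h2 : (c - e / 2) * M <= (t * a + (1 - t) * g j x) * M.
  by rewrite ler_pM2r//; lra.
have h3 : 2 * B <= e / 2 * M by rewrite -ler_pdivrMr.
move: d2; rewrite ler_norml => /andP[d2 _].
lra.
Qed.

End Minimax.

(** * Compactness of [K] and of the Lipschitz ball *)

Section GradientImage.
Variables (R : realType) (D : nat) (xi : 'M[R]_D -> R).
Hypothesis xi_smooth : smooth xi.
Local Notation K := (Kxi xi).

Definition psd_ball : set (Mat R D) := [set A | psd A /\ frob A <= 1].

Lemma psd_ball0 : psd_ball 0.
Proof. by split; [exact: psd0|rewrite frob0]. Qed.

Lemma grad_continuous (A : 'M[R]_D) (e : R) : 0 < e -> exists d : R, 0 < d /\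
  forall B, frob (B - A) < d -> frob (grad xi B - grad xi A) < e.
Proof.
move=> e0; pose e' := e / ((D ^ 2)%:R + 1).
have D0 : 0 < (D ^ 2)%:R + 1 :> R by rewrite ltr_wpDl.
have e'0 : 0 < e' by rewrite divr_gt0.
have /choice[f fP] (p : 'I_D * 'I_D) : exists d : R, 0 < d /\ forall B, frob (B - A) < d ->
    `|dirD (delta_mx p.1 p.2) xi B - dirD (delta_mx p.1 p.2) xi A| < e'.
  have [C _] := xi_smooth [:: delta_mx p.1 p.2].
  exact: (C A e' e'0).
exists (\big[Order.min/1]_p f p); split.
  by apply: lt_bigmin => // p _; case: (fP p).
move=> B AB; apply: le_lt_trans (_ : (D ^ 2)%:R * e' < e).
  apply: frob_le_entries => i j; rewrite !mxE; apply: ltW.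
  have [_] := fP (i, j); apply; apply: lt_le_trans AB _.
  exact: bigmin_le_cond.
by rewrite /e' mulrCA gtr_pMr// ltr_pdivrMr// mul1r ltrDl.
Qed.

Lemma psd_closed (A : 'M[R]_D) : (forall e : R, 0 < e -> exists B, psd B /\ frob (B - A) < e) -> psd A.
Proof.
move=> H; split.
  apply/matrixP => i j; rewrite mxE; apply/eqP; rewrite -subr_eq0 -normr_le0.
  apply/ler_addgt0Pl => e e0; rewrite addr0.
  have [|B [[tB _] BA]] := H (e / 2); first by rewrite divr_gt0.
  have h1 := entry_le_frob (B - A) i j; have h2 := entry_le_frob (B - A) j i.
  rewrite !mxE in h1 h2; have E : B j i = B i j by rewrite -{1}tB mxE.
  rewrite E in h2.
  have -> : A j i - A i j = (B i j - A i j) - (B i j - A j i) by ring.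
  by apply: le_trans (ler_normB _ _) _; lra.
move=> x; pose c := \sum_i \sum_j `|x i 0| * `|x j 0|.
have c0 : 0 <= c by apply: sumr_ge0 => i _; apply: sumr_ge0 => j _; rewrite mulr_ge0.
apply/ler_addgt0Pl => e e0.
have [|B [[_ pB] BA]] := H (e / (c + 1)); first by rewrite divr_gt0// ltr_wpDl.
have E : (x^T *m B *m x) 0 0 = (x^T *m (B - A) *m x) 0 0 + (x^T *m A *m x) 0 0.
  by rewrite -[in LHS](subrK A B) mulmxDr mulmxDl mxE.
have := pB x; rewrite E => b0.
suff h : (x^T *m (B - A) *m x) 0 0 <= e by lra.
rewrite qformE; apply: le_trans (_ : c * frob (B - A) <= _).
  rewrite /c mulr_suml; apply: ler_sum => i _; rewrite mulr_suml; apply: ler_sum => j _.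
  apply: le_trans (ler_norm _) _; rewrite !normrM mulrAC ler_wpM2l ?mulr_ge0//.
  exact: entry_le_frob.
apply: le_trans (_ : c * (e / (c + 1)) <= _); first by rewrite ler_wpM2l// ltW.
by rewrite mulrCA ger_pMr// ler_pdivrMr ?mul1r ?lerDl// ltr_wpDl.
Qed.

Lemma psd_ball_cluster (u : nat -> 'M[R]_D) : (forall n, psd_ball (u n)) ->
  exists A, psd_ball A /\ forall (e : R) N, 0 < e -> exists2 n, (N <= n)%N & frob (u n - A) < e.
Proof.
move=> uB.
have [|f fP] := @cluster_point R ('I_D * 'I_D)%type (fun n p => u n p.1 p.2) 1.
  by move=> n p; apply: le_trans (entry_le_frob _ _ _) _; case: (uB n).
pose A : 'M[R]_D := \matrix_(i, j) f (i, j).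
have cl (e : R) N : 0 < e -> exists2 n, (N <= n)%N & frob (u n - A) < e.
  move=> e0; have D0 : 0 < (D ^ 2)%:R + 1 :> R by rewrite ltr_wpDl.
  have [|n Nn h] := fP (enum {: 'I_D * 'I_D}) (e / ((D ^ 2)%:R + 1)) N; first by rewrite divr_gt0.
  exists n => //; apply: le_lt_trans (_ : (D ^ 2)%:R * (e / ((D ^ 2)%:R + 1)) < e).
    apply: frob_le_entries => i j; rewrite !mxE; apply: ltW.
    by apply: (h (i, j)); rewrite mem_enum.
  by rewrite mulrCA gtr_pMr// ltr_pdivrMr// mul1r ltrDl.
exists A; split=> //; split.
  apply: psd_closed => e e0; have [n _ h] := cl e 0%N e0.
  by exists (u n); split=> //; case: (uB n).
apply/ler_addgt0Pl => e e0; have [n _ h] := cl e 0%N e0.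
have [_ un] := uB n; have := ler_frob_dist (u n) A; rewrite ler_norml => /andP[_ h2].
have := ler_frob_dist A (u n); rewrite frobC ler_norml => /andP[_ h3]; lra.
Qed.

Lemma grad_bounded : exists G : R, 0 <= G /\ forall A, psd_ball A -> frob (grad xi A) <= G.
Proof.
move: grad_continuous; move: (grad xi) => g g_continuous.
apply: contrapT => H.
have /choice[u uP] (n : nat) : exists A, psd_ball A /\ n%:R < frob (g A).
  apply: contrapT => H2; apply: H; exists n%:R; split=> // A BA.
  by rewrite leNgt; apply/negP => h; apply: H2; exists A.
have [|A [_ cl]] := @psd_ball_cluster u; first by move=> n; case: (uP n).
have [d [d0 dP]] := g_continuous A 1 ltr01.
have [n Nn /dP h] := cl d (Num.truncn (frob (g A) + 1)).+1 d0.
have [_ un] := uP n.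
have := ler_frob_dist (g (u n)) (g A); rewrite ler_norml => /andP[_ h2].
have h3 : frob (g A) + 1 < n%:R.
  by apply: lt_le_trans (truncnS_gt _) _; rewrite ler_nat.
lra.
Qed.

(** Uniform continuity in affine form: over a partition of a monotone path the terms
    [C * frob (A - B)] add up to at most a multiple of its variation, whatever the size of its
    jumps. *)
Lemma grad_modulus (e : R) : 0 < e -> exists C : R, 0 <= C /\
  forall A B, psd_ball A -> psd_ball B -> frob (grad xi A - grad xi B) <= e + C * frob (A - B).
Proof.
move: grad_continuous grad_bounded; move: (grad xi) => g g_continuous [G [G0 GP]].
move=> e0; apply: contrapT => H.
have /choice[u uP] (n : nat) : exists p : 'M[R]_D * 'M[R]_D, [/\ psd_ball p.1, psd_ball p.2 &
    e + n%:R * frob (p.1 - p.2) < frob (g p.1 - g p.2)].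
  apply: contrapT => H2; apply: H; exists n%:R; split=> // A B BA BB.
  by rewrite leNgt; apply/negP => h; apply: H2; exists (A, B).
have [|A [_ cl]] := @psd_ball_cluster (fst \o u); first by move=> n; case: (uP n).
have e2 : 0 < e / 2 by lra.
have [d [d0 dP]] := g_continuous A _ e2.
have d2 : 0 < d / 2 by lra.
(* With [n > 4 * G / d], the bound [2 * G] on the difference of two gradients forces the two points
   of [u n] to be closer than [d / 2]. *)
have [n Nn h] := cl (d / 2) (Num.truncn (4 * G / d)).+1 d2.
have [B1 B2 hn] := uP n; rewrite /= in h.
have h1 : frob (g (u n).1 - g A) < e / 2 by apply: dP; lra.
have hG : frob (g (u n).1 - g (u n).2) <= 2 * G.
  apply: le_trans (frobD _ _) _; rewrite frobN; have := GP _ B1; have := GP _ B2; lra.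
have h3 : 4 * G / d < n%:R.
  by apply: lt_le_trans (truncnS_gt _) _; rewrite ler_nat.
rewrite ltr_pdivrMr// in h3.
have h4 : frob ((u n).1 - (u n).2) < d / 2.
  rewrite ltNge; apply/negP => h5.
  have : n%:R * (d / 2) <= n%:R * frob ((u n).1 - (u n).2) by apply: ler_wpM2l.
  lra.
have h5 : frob (g (u n).2 - g A) < e / 2.
  apply: dP; apply: le_lt_trans (frobB_trans _ (u n).1 _) _.
  by rewrite (frobC (u n).2); lra.
have := frobB_trans (g (u n).1) (g A) (g (u n).2).
rewrite (frobC (g A)); have : 0 <= n%:R * frob ((u n).1 - (u n).2).
  by rewrite mulr_ge0// frob_ge0.
lra.
Qed.

Lemma Kxi_x0 : K (x0 xi).
Proof. by exists 0 => //; exact: psd_ball0. Qed.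

Lemma Kxi_closed x : (forall e : R, 0 < e -> exists y, K y /\ frob (y - x) < e) -> K x.
Proof.
move=> H.
have /choice[u uP] (n : nat) : exists A, psd_ball A /\ frob (grad xi A - x) < n.+1%:R^-1.
  by have [|_ [[A BA <-] h]] := H n.+1%:R^-1; [rewrite invr_gt0 ltr0Sn|exists A].
have [|A [BA cl]] := @psd_ball_cluster u; first by move=> n; case: (uP n).
suff -> : x = grad xi A by exists A.
apply/eqP; rewrite -subr_eq0; apply/eqP/frob_eq0/ler_addgt0Pl => e e0; rewrite addr0.
have e2 : 0 < e / 2 by lra.
have [d [d0 dP]] := grad_continuous A e2.
have [n Nn /dP h] := cl d (Num.truncn (2 / e)).+1 d0.
have [_ h1] := uP n.
have h2 : n.+1%:R^-1 <= e / 2.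
  rewrite -[e / 2]invrK lef_pV2 ?posrE ?invr_gt0 ?ltr0Sn//.
  rewrite invf_div; apply: le_trans (ltW (truncnS_gt _)) _.
  by rewrite ler_nat leqW.
apply: le_trans (frobB_trans _ (grad xi (u n)) _) _.
rewrite (frobC x (grad xi (u n))) [leRHS]splitr.
by apply: lerD; [exact: le_trans (ltW h1) h2|exact: ltW].
Qed.

Lemma Kxi_net (e : R) : 0 < e -> exists n (t : 'I_n -> 'M[R]_D),
  (forall k, K (t k)) /\ forall x, K x -> exists k, frob (x - t k) <= e.
Proof.
move=> e0; have [G [G0 GP]] := grad_bounded.
have D0 : 0 < (D ^ 2)%:R + 1 :> R by rewrite ltr_wpDl.
have e'0 : 0 < e / ((D ^ 2)%:R + 1) by rewrite divr_gt0.
have [|n [t [tK tP]]] := @finite_net R _ ('I_D * 'I_D)%type K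
    (fun (x : Mat R D) p => x p.1 p.2) G _ e'0.
  move=> x p [A BA <-]; apply: le_trans (GP A BA); exact: entry_le_frob.
exists n, t; split=> // x /tP[k kP]; exists k.
apply: le_trans (_ : (D ^ 2)%:R * (e / ((D ^ 2)%:R + 1)) <= e).
  by apply: frob_le_entries => i j; rewrite !mxE; exact: (kP (i, j)).
by rewrite mulrCA ger_pMr// ler_pdivrMr// mul1r lerDl.
Qed.

Lemma Lle1_bounded : exists C : R, 0 <= C /\
  forall chi, Lle1 xi chi -> forall x, K x -> `|chi x| <= C.
Proof.
have [G [G0 GP]] := grad_bounded; exists (1 + 2 * G); split; first lra.
move=> chi [c0 cl] x Kx; have h := cl _ _ Kx Kxi_x0.
have hx : frob x <= G by case: Kx => A BA <-; exact: GP.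
have hx0 : frob (x0 xi) <= G by apply: GP; exact: psd_ball0.
have := frobD x (- x0 xi); rewrite frobN => h2.
have := ler_normD (chi x - chi (x0 xi)) (chi (x0 xi)); rewrite subrK; lra.
Qed.

Lemma Lle1_cst (c : R) : `|c| <= 1 -> Lle1 xi (fun=> c).
Proof.
by move=> c1; split=> // x y _ _; rewrite subrr normr0 mul1r frob_ge0.
Qed.

Lemma Lle1_comb (t : R) (f g : Mat R D -> R) : 0 <= t <= 1 -> Lle1 xi f -> Lle1 xi g ->
  Lle1 xi (fun x => t * f x + (1 - t) * g x).
Proof.
move=> /andP[t0 t1] [f0 fl] [g0 gl].
have u0 : 0 <= 1 - t by lra.
have H (a b c : R) : `|a| <= c -> `|b| <= c -> `|t * a + (1 - t) * b| <= c.
  move=> ac bc; apply: le_trans (ler_normD _ _) _; rewrite !normrM (ger0_norm t0) (ger0_norm u0).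
  have -> : c = t * c + (1 - t) * c by ring.
  by apply: lerD; apply: ler_wpM2l.
split; first exact: H.
move=> x y Kx Ky.
have -> : t * f x + (1 - t) * g x - (t * f y + (1 - t) * g y) =
   t * (f x - f y) + (1 - t) * (g x - g y) by ring.
by apply: H; [exact: fl|exact: gl].
Qed.

(** An [e / 3]-net of [K] reduces a Lipschitz function to finitely many values: one third of [e] is
    spent on these values, two on moving to a nearby net point and back. *)
Lemma Lle1_net (e : R) : 0 < e -> exists n (s : 'I_n -> Mat R D -> R),
  (forall k, Lle1 xi (s k)) /\
  forall chi, Lle1 xi chi -> exists k, forall x, K x -> `|chi x - s k x| <= e.
Proof.
move=> e0; have e3 : 0 < e / 3 by lra.
have [n [t [tK tP]]] := Kxi_net e3.
have [C [C0 CP]] := Lle1_bounded.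
have [|m [s [sL sP]]] := @finite_net R (Mat R D -> R) 'I_n (Lle1 xi) (fun chi k => chi (t k)) C _ e3.
  by move=> chi k L; apply: CP.
exists m, s; split=> // chi L; have [k kP] := sP chi L; exists k => x Kx.
have [i xi_] := tP x Kx.
have h1 := L.2 _ _ Kx (tK i); have h2 := (sL k).2 _ _ (tK i) Kx; have h3 := kP i.
rewrite frobC in h2.
have -> : chi x - s k x = (chi x - chi (t i)) + (chi (t i) - s k (t i)) + (s k (t i) - s k x) by ring.
apply: le_trans (ler_normD _ _) _; apply: le_trans (lerD (ler_normD _ _) (lexx _)) _.
lra.
Qed.

(** Arzela-Ascoli: through a finite net of [K], the common Lipschitz bound turns a cluster point for
    pointwise convergence into one for uniform convergence. *)
Lemma Lle1_cluster (u : nat -> Mat R D -> R) : (forall n, Lle1 xi (u n)) ->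
  exists chi, Lle1 xi chi /\ forall (e : R) N, 0 < e ->
    exists2 n, (N <= n)%N & forall x, K x -> `|u n x - chi x| <= e.
Proof.
move=> uL; have [C [C0 CP]] := Lle1_bounded.
(* [Lle1] says nothing outside [K], where the [u n] may be unbounded, hence the cut-off. *)
pose v n (x : Mat R D) := if x \in K then u n x else 0.
have [|f fP] := @cluster_point R (Mat R D) v C.
  by move=> n x; rewrite /v; case: ifPn => [/set_mem Kx|_]; [exact: CP|rewrite normr0].
have vE n x : K x -> v n x = u n x by move=> Kx; rewrite /v mem_set.
have fL : Lle1 xi f.
  split.
    apply/ler_addgt0Pl => e e0.
    have [n _ /(_ (x0 xi))] := fP [:: x0 xi] e 0%N e0.
    rewrite inE eqxx => /(_ isT); rewrite vE; last exact: Kxi_x0.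
    have := (uL n).1 => h1 h2.
    have := ler_normD (- (u n (x0 xi) - f (x0 xi))) (u n (x0 xi)).
    by rewrite normrN opprB subrK; lra.
  move=> x y Kx Ky; rewrite mul1r; apply/ler_addgt0Pl => e e0.
  have e2 : 0 < e / 2 by lra.
  have [n _ H] := fP [:: x; y] (e / 2) 0%N e2.
  have hx := H x; have hy := H y; rewrite !inE !eqxx orbT in hx hy.
  have {hx} := hx isT; have {hy} := hy isT; rewrite !vE// => hy hx.
  have h := (uL n).2 _ _ Kx Ky.
  have -> : f x - f y = - (u n x - f x) + (u n x - u n y) + (u n y - f y) by ring.
  apply: le_trans (ler_normD _ _) _; apply: le_trans (lerD (ler_normD _ _) (lexx _)) _.
  rewrite normrN; lra.
exists f; split=> // e N e0; have e3 : 0 < e / 3 by lra.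
have [m [t [tK tP]]] := Kxi_net e3.
have [n Nn H] := fP (codom t) (e / 3) N e3.
exists n => // x Kx; have [i xi_] := tP x Kx.
have h1 := (uL n).2 _ _ Kx (tK i); have h2 := fL.2 _ _ (tK i) Kx.
have := H (t i) (codom_f _ _); rewrite vE// => h3.
rewrite frobC in h2.
have -> : u n x - f x = (u n x - u n (t i)) + (u n (t i) - f (t i)) + (f (t i) - f x) by ring.
apply: le_trans (ler_normD _ _) _; apply: le_trans (lerD (ler_normD _ _) (lexx _)) _.
lra.
Qed.

(** Members of [Lle1] are arbitrary outside [K]. The extension is Lipschitz on the whole matrix
    space, hence Borel, and this is how measurability on [K] is obtained. *)
Lemma Lle1_extension chi : Lle1 xi chi -> exists chi' : Mat R D -> R,
  (forall x y, `|chi' x - chi' y| <= frob (x - y)) /\ forall x, K x -> chi' x = chi x.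
Proof.
move=> L; have [C [C0 CP]] := Lle1_bounded.
pose I := {x | K x}.
have lbd (z : 'M[R]_D) : exists b, forall i : I, b <= chi (sval i) + frob (z - sval i).
  exists (- C) => -[x Kx] /=; have := CP _ L x Kx; rewrite ler_norml => /andP[h _].
  by have := frob_ge0 (z - x); lra.
have iI : inhabited I by exists; exists (x0 xi); exact: Kxi_x0.
exists (infconv (fun i : I => sval i) (fun i => chi (sval i))); split.
  by move=> x y; exact: infconv_lip.
move=> x Kx; apply/eqP; rewrite eq_le; apply/andP; split.
  have := infconv_le lbd iI x (exist _ x Kx); by rewrite /= subrr frob0 addr0.
apply: infconv_ge => // -[y Ky] /=.
by have := L.2 _ _ Kx Ky; rewrite ler_norml => /andP[_]; lra.
Qed.

End GradientImage.

(** * Integration over [K] *)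

Section IntegralOnK.
Variables (R : realType) (D : nat) (xi : 'M[R]_D -> R).
Hypothesis xi_smooth : smooth xi.
Local Notation K := (Kxi xi).
Local Notation BMat := (g_sigma_algebraType (@frob_open R D)).
Implicit Types (f g : Mat R D -> R).

Lemma frob_open_measurable (A : set (Mat R D)) :
  frob_open A -> measurable (A : set BMat).
Proof. exact: sub_sigma_algebra. Qed.

Lemma lip_measurable f (L : R) :
  (forall x y, `|f x - f y| <= L * frob (x - y)) -> measurable_fun setT (f : BMat -> R).
Proof.
move=> fL; apply: (measurability _ (RGenOInfty.measurableE R)) => //= _ [_ [r ->] <-].
rewrite setTI; apply: frob_open_measurable => x /=; rewrite in_itv /= andbT => rx.
have L1 : 0 < `|L| + 1 by rewrite ltr_wpDl.
exists ((f x - r) / (`|L| + 1)); split; first by rewrite divr_gt0// subr_gt0.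
move=> y; rewrite ltr_pdivlMr// in_itv /= andbT => yx.
have := fL y x; rewrite ler_norml => /andP[h _].
have : L * frob (y - x) <= frob (y - x) * (`|L| + 1).
  rewrite mulrC ler_wpM2l ?frob_ge0//.
  by apply: le_trans (ler_norm _) _; rewrite lerDl.
move: (frob _) yx h => a yx h; lra.
Qed.

Lemma measurable_Kxi : measurable (K : set BMat).
Proof.
rewrite -[K]setCK; apply: measurableC; apply: frob_open_measurable => x /= nKx.
apply: contrapT => H; apply: nKx; apply: Kxi_closed => // e e0.
apply: contrapT => H2; apply: H; exists e; split=> // y yx Ky.
by apply: H2; exists y.
Qed.

Definition bounded_mfun f := measurable_fun (K : set BMat) (f : BMat -> R) /\
  exists C, forall x, K x -> `|f x| <= C.

Lemma bounded_mfun_cst (c : R) : bounded_mfun (fun=> c).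
Proof. by split; [exact: measurable_cst|exists `|c|]. Qed.

Lemma bounded_mfunD f g : bounded_mfun f -> bounded_mfun g ->
  bounded_mfun (fun x => f x + g x).
Proof.
move=> [mf [C fC]] [mg [C' gC]]; split; first exact: measurable_funD.
exists (C + C') => x Kx; apply: le_trans (ler_normD _ _) _.
by apply: lerD; [exact: fC|exact: gC].
Qed.

Lemma bounded_mfunZ (c : R) f : bounded_mfun f -> bounded_mfun (fun x => c * f x).
Proof.
move=> [mf [C fC]]; split; first by apply: measurable_funM => //; exact: measurable_cst.
by exists (`|c| * C) => x Kx; rewrite normrM ler_wpM2l// fC.
Qed.

Lemma bounded_mfun_lip f (L : R) : (forall x y, `|f x - f y| <= L * frob (x - y)) ->
  bounded_mfun f.
Proof.
move=> fL; split; first by apply: measurable_funTS; apply: lip_measurable fL.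
have [G [G0 GP]] := grad_bounded xi_smooth.
exists (`|f 0| + `|L| * G) => _ [A BA <-].
have h := fL (grad xi A) 0; rewrite subr0 in h.
have h2 : L * frob (grad xi A) <= `|L| * G.
  apply: le_trans (ler_wpM2l (normr_ge0 L) (GP A BA)).
  by rewrite ler_wpM2r ?frob_ge0// ler_norm.
have := ler_normD (f (grad xi A) - f 0) (f 0); rewrite subrK.
move: (frob _) h h2 => a h h2; lra.
Qed.

Lemma bounded_mfun_Lle1 f : Lle1 xi f -> bounded_mfun f.
Proof.
move=> fL; have [f' [f'L f'E]] := Lle1_extension xi_smooth fL.
have [C [_ CP]] := Lle1_bounded xi_smooth; split; last by exists C; exact: CP.
apply: (@eq_measurable_fun _ _ BMat R K f') => [x /set_mem Kx|]; first exact: f'E.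
apply: measurable_funTS; apply: (@lip_measurable _ 1) => x y.
by rewrite mul1r.
Qed.

Section FiniteMeasure.
Variable mu : {finite_measure set BMat -> \bar R}.

Lemma intK_integrable f : bounded_mfun f -> mu.-integrable (K : set BMat) (EFin \o f).
Proof.
move=> [mf [C fC]]; apply: measurable_bounded_integrable => //.
- exact: measurable_Kxi.
- by rewrite ltey_eq fin_num_measure//; exact: measurable_Kxi.
- exists C; split; first exact: num_real.
  by move=> M CM x Kx; apply: le_trans (fC x Kx) (ltW CM).
Qed.

Lemma intK_D f g : bounded_mfun f -> bounded_mfun g ->
  intK xi mu (fun x => f x + g x) = intK xi mu f + intK xi mu g.
Proof.
move=> bf bg; apply: (@RintegralD _ BMat _ mu) => //; first exact: measurable_Kxi.
  exact: intK_integrable.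
exact: intK_integrable.
Qed.

Lemma intK_Z (c : R) f : bounded_mfun f ->
  intK xi mu (fun x => c * f x) = c * intK xi mu f.
Proof.
move=> bf; apply: (@RintegralZl _ BMat _ mu) => //; first exact: measurable_Kxi.
exact: intK_integrable.
Qed.

Lemma intK_B f g : bounded_mfun f -> bounded_mfun g ->
  intK xi mu (fun x => f x - g x) = intK xi mu f - intK xi mu g.
Proof.
move=> bf bg; apply: (@RintegralB _ BMat _ mu) => //; first exact: measurable_Kxi.
  exact: intK_integrable.
exact: intK_integrable.
Qed.

Lemma intK_cst (c : R) : intK xi mu (fun=> c) = c * fine (mu K).
Proof. by apply: (@Rintegral_cst _ BMat _ mu); exact: measurable_Kxi. Qed.

Lemma intK_le f g : bounded_mfun f -> bounded_mfun g ->
  (forall x, K x -> f x <= g x) -> intK xi mu f <= intK xi mu g.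
Proof.
move=> bf bg; apply: (@le_Rintegral _ BMat _ mu) => //; first exact: measurable_Kxi.
  exact: intK_integrable.
exact: intK_integrable.
Qed.

Lemma eq_intK f g : (forall x, K x -> f x = g x) -> intK xi mu f = intK xi mu g.
Proof.
by move=> fg; congr fine; apply: eq_integral => x /set_mem Kx; rewrite fg.
Qed.

Lemma intK_dist f g (d : R) : bounded_mfun f -> bounded_mfun g ->
  (forall x, K x -> `|f x - g x| <= d) -> `|intK xi mu f - intK xi mu g| <= d * fine (mu K).
Proof.
move=> bf bg fgd; rewrite -intK_B// -intK_cst.
have bfg : bounded_mfun (fun x => f x - g x).
  rewrite (_ : (fun x => _) = (fun x => f x + (-1) * g x)).
    by apply: bounded_mfunD => //; exact: bounded_mfunZ.
  by apply/funext => x; rewrite mulN1r.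
rewrite ler_norml; apply/andP; split.
  rewrite -mulN1r -intK_Z; last exact: bounded_mfun_cst.
  apply: intK_le => //; first exact/bounded_mfunZ/bounded_mfun_cst.
  by move=> x Kx; have := fgd x Kx; rewrite ler_norml mulN1r => /andP[].
apply: intK_le => //; first exact: bounded_mfun_cst.
by move=> x Kx; apply: le_trans (ler_norm _) (fgd x Kx).
Qed.

End FiniteMeasure.

Lemma intK_dist_prob (mu : Prob R D) f g (d : R) : bounded_mfun f -> bounded_mfun g -> 0 <= d ->
  (forall x, K x -> `|f x - g x| <= d) -> `|intK xi mu f - intK xi mu g| <= d.
Proof.
move=> bf bg d0 fgd; apply: le_trans (@intK_dist mu _ _ _ bf bg fgd) _.
rewrite ler_piMr// -lee_fin fineK.
  by apply: probability_le1; exact: measurable_Kxi.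
by apply: fin_num_measure; exact: measurable_Kxi.
Qed.

End IntegralOnK.

(** * Uniform averages of probability measures *)

Section Average.
Context d (T : measurableType d) (R : realType) (n : nat) (P : 'I_n.+1 -> probability T R).

Let c : {nonneg R} := (n.+1%:R^-1)%:nng.

(** [msum] sums a family indexed by [nat], hence [inord]; the size [n.+1] excludes empty
    averages. *)
Definition pavg : set T -> \bar R := mscale c (msum (fun k => P (inord k)) n.+1).
HB.instance Definition _ := Measure.on pavg.

Lemma pavgE A : pavg A = ((n.+1%:R^-1)%:E * \sum_(i < n.+1) P i A)%E.
Proof.
rewrite /pavg /mscale /msum /=; congr (_ * _)%E.
by apply: eq_bigr => i _; rewrite inord_val.
Qed.

Let pavg_setT : pavg setT = 1%E.
Proof.
rewrite pavgE (eq_bigr (fun=> 1%E)); last by move=> i _; rewrite probability_setT.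
by rewrite sumEFin big_const_ord iter_addr_0 -EFinM mulVf ?pnatr_eq0.
Qed.

HB.instance Definition _ := Measure_isProbability.Build _ _ _ pavg pavg_setT.

Lemma Rintegral_pavg (E : set T) (f : T -> R) : measurable E -> measurable_fun E f ->
  (exists C, forall x, E x -> `|f x| <= C) ->
  fine (\int[pavg]_(x in E) (f x)%:E) =
    n.+1%:R^-1 * \sum_(i < n.+1) fine (\int[P i]_(x in E) (f x)%:E).
Proof.
move=> mE mf [C fC].
have bf (m : probability T R) : m.-integrable E (EFin \o f).
  apply: measurable_bounded_integrable => //.
    by rewrite ltey_eq fin_num_measure.
  exists C; split; first exact: num_real.
  by move=> M CM x Ex; apply: le_trans (fC x Ex) (ltW CM).
have bc (m : probability T R) (r : R) : m.-integrable E (EFin \o (fun=> r)).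
  apply: measurable_bounded_integrable => //.
    by rewrite ltey_eq fin_num_measure.
  exact: bounded_cst.
(* Integrals against [mscale] and [msum] are split for non-negative integrands, so [f] is raised by
   its bound [C]. *)
have shift (m : probability T R) : fine (\int[m]_(x in E) (f x)%:E) =
    fine (\int[m]_(x in E) (f x + C)%:E) - C * fine (m E).
  have := RintegralD mE (bf m) (bc m C); rewrite /Rintegral => ->.
  by have := Rintegral_cst m mE C; rewrite /Rintegral => ->; rewrite addrK.
rewrite shift; under eq_bigr do rewrite shift.
rewrite sumrB mulrBr; congr (_ - _).
- have mfC : measurable_fun E (fun x => (f x + C)%:E).
    by apply/measurable_EFinP; apply: measurable_funD.
  have fC0 x : E x -> (0 <= (f x + C)%:E)%E.
    by move=> Ex; rewrite lee_fin; have := fC x Ex; rewrite ler_norml => /andP[]; lra.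
  rewrite ge0_integral_mscale//= ge0_integral_measure_sum//.
  rewrite fineM//; last first.
    apply/sum_fin_numP => i _ _; apply: integrable_fin_num => //.
    by have := integrableD mE (bf (P (inord i))) (bc (P (inord i)) C).
  congr (_ * _).
  rewrite -sum_fine; last first.
    move=> i _; apply: integrable_fin_num => //.
    by have := integrableD mE (bf (P (inord i))) (bc (P (inord i)) C).
  by apply: eq_bigr => i _; rewrite inord_val.
rewrite -mulr_sumr mulrCA; congr (C * _).
rewrite -[LHS]/(fine (pavg E)) pavgE fineM//; last first.
  by apply/sum_fin_numP => i _ _; exact: fin_num_measure.
by rewrite -sum_fine// => i _; exact: fin_num_measure.
Qed.

End Average.

(** * Right-continuous paths, step approximation and laws of paths *)

Section RightContinuousPath.
Variables (R : realType) (D : nat) (p : R -> 'M[R]_D).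
Local Notation BMat := (g_sigma_algebraType (@frob_open R D)).

Definition path_right_continuous := forall u : R, 0 <= u < 1 -> forall e : R, 0 < e ->
  exists d : R, 0 < d /\ forall v, u <= v < 1 -> v < u + d -> frob (p v - p u) < e.

Hypothesis p_rc : path_right_continuous.

(* The preimage of an open set is a union, over the rationals [r], of the
   intervals of the points [u < r] such that [p] maps [[u, r[] into the set. *)
Lemma measurable_path :
  measurable_fun (`[0, 1[%classic : set (measurableTypeR R)) (p : measurableTypeR R -> BMat).
Proof.
apply: (@measurability _ _ (measurableTypeR R) BMat _ _ (@frob_open R D)) => // _ [A oA <-].
pose S (r : rat) := [set u : R | [/\ 0 <= u < 1, u < ratr r &
  forall v, u <= v -> v < ratr r -> v < 1 -> A (p v)]].
suff -> : `[0, 1[%classic `&` p @^-1` A = \bigcup_r S r.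
  apply: bigcupT_measurable_rat => r; apply: is_interval_measurable.
  move=> x y [/andP[x0 x1] xr xA] [/andP[y0 y1] yr yA] z /andP[xz zy]; split.
  - by rewrite (le_trans x0 xz) (le_lt_trans zy y1).
  - exact: le_lt_trans zy yr.
  - by move=> v zv; apply: xA; exact: le_trans zv.
apply/seteqP; split=> [u [/=]|u [r _ [u01 ur H]]]; last first.
  split; first by rewrite /= in_itv.
  by apply: H => //; case/andP: u01.
rewrite in_itv /= => u01 Au; have [e [e0 eA]] := oA _ Au.
have [d [d0 dP]] := p_rc u01 e0.
have /rat_in_itvoo[r] : u < u + d by rewrite ltrDl.
rewrite in_itv /= => /andP[ur rd]; exists r => //; split=> // v uv vr v1.
by apply: eA; apply: dP; [rewrite uv|exact: lt_trans rd].
Qed.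

End RightContinuousPath.

Section StepIntegral.
Variables (R : realType) (f : R -> R) (C : R).
Hypothesis mf : measurable_fun (`[0, 1[%classic : set (measurableTypeR R)) f.
Hypothesis fC : forall u, 0 <= u < 1 -> `|f u| <= C.
Local Notation leb := (@lebesgue_measure R).

Lemma unit_integrable (a b : R) : 0 <= a -> b <= 1 ->
  leb.-integrable (`[a, b[%classic) (EFin \o f).
Proof.
move=> a0 b1; have sub : (`[a, b[ `<=` `[0, 1[)%classic.
  by move=> u /=; rewrite !in_itv /= => /andP[au ub]; rewrite (le_trans a0 au) (lt_le_trans ub b1).
apply: measurable_bounded_integrable => //.
- by rewrite /= lebesgue_measure_itv /=; case: ifP => // _; rewrite -EFinB ltry.
- exact: measurable_funS mf.
- exists C; split; first exact: num_real.
  move=> M CM u /sub; rewrite /= in_itv /= => u01.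
  by apply: le_trans (fC u01) (ltW CM).
Qed.

Lemma itv_integral_dist (a b c e : R) : 0 <= a -> a <= b -> b <= 1 ->
  (forall u, a <= u < b -> `|f u - c| <= e) ->
  `|Rintegral leb `[a, b[%classic f - (b - a) * c| <= (b - a) * e.
Proof.
move=> a0 ab b1 H.
have intc (r : R) : leb.-integrable (`[a, b[%classic) (EFin \o (fun=> r)).
  apply: measurable_bounded_integrable => //.
    by rewrite /= lebesgue_measure_itv /=; case: ifP => // _; rewrite -EFinB ltry.
  exact: bounded_cst.
have cstE (r : R) : Rintegral leb `[a, b[%classic (fun=> r) = (b - a) * r.
  rewrite Rintegral_cst//= lebesgue_measure_itv/= mulrC; congr (_ * _).
  case: ifPn => [_|]; first by rewrite -EFinB.
  by rewrite lte_fin -leNgt /= => ba; apply/eqP; rewrite eq_sym subr_eq0 eq_le ba ab.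
have intf := unit_integrable a0 b1.
rewrite ler_norml; apply/andP; split.
  rewrite lerBrDr addrC -mulrBr -cstE; apply: le_Rintegral => // u /=.
  rewrite in_itv /= => uab; have := H u uab; rewrite ler_norml => /andP[]; lra.
rewrite lerBlDr -mulrDr -cstE; apply: le_Rintegral => // u /=.
rewrite in_itv /= => uab; have := H u uab; rewrite ler_norml => /andP[]; lra.
Qed.

(** Each cell has its own error [e k]: a monotone path may jump in some cells, and only the sum of
    its oscillations is controlled. *)
Lemma step_integral (c e : nat -> R) (N : nat) : (0 < N)%N ->
  (forall k u, (k < N)%N -> k%:R / N%:R <= u < k.+1%:R / N%:R -> `|f u - c k| <= e k) ->
  `|Rintegral leb `[0, 1[%classic f - N%:R^-1 * \sum_(k < N) c k| <= N%:R^-1 * \sum_(k < N) e k.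
Proof.
move=> N0 H; have Npos : 0 < N%:R :> R by rewrite ltr0n.
suff S m : (m <= N)%N -> `|Rintegral leb `[0, (m%:R / N%:R)[%classic f -
    N%:R^-1 * \sum_(k < m) c k| <= N%:R^-1 * \sum_(k < m) e k.
  by have := S N (leqnn N); rewrite divff ?gt_eqF.
elim: m => [_|m IH mN].
  by rewrite mul0r set_itvco0 Rintegral_set0 !big_ord0 mulr0 subr0 normr0.
have m0 : 0 <= m%:R / N%:R :> R by rewrite divr_ge0.
have mm : m%:R / N%:R <= m.+1%:R / N%:R :> R by rewrite ler_pM2r ?invr_gt0// ler_nat.
have m1 : m.+1%:R / N%:R <= 1 :> R by rewrite ler_pdivrMr// mul1r ler_nat.
rewrite (@itv_bndbnd_setU _ _ (BLeft 0) (BLeft (m%:R / N%:R))) ?bnd_simp//.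
have U : (`[0, (m%:R / N%:R)[ `|` `[(m%:R / N%:R), (m.+1%:R / N%:R)[ =
   `[0, (m.+1%:R / N%:R)[ :> set R)%classic.
  by rewrite -itv_bndbnd_setU// bnd_simp.
rewrite Rintegral_setU//; last 2 first.
- by rewrite U; exact: unit_integrable.
- apply/disj_setPRL => u /=; rewrite !in_itv /= => /andP[h _] /andP[_ h2].
  by have := lt_le_trans h2 h; rewrite ltxx.
rewrite !big_ord_recr /= !mulrDr.
have h1 := IH (ltnW mN).
have := @itv_integral_dist (m%:R / N%:R) (m.+1%:R / N%:R) (c m) (e m) m0 mm m1
  (fun u => H m u mN).
rewrite -mulrBl -natrB// subSnn mul1r => h2.
set A := Rintegral _ _ _ in h1 *; set B := Rintegral _ _ _ in h2 *.
have -> : A + B - (N%:R^-1 * \sum_(i < m) c i + N%:R^-1 * c m) =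
  (A - N%:R^-1 * \sum_(i < m) c i) + (B - N%:R^-1 * c m) by ring.
by apply: le_trans (ler_normD _ _) _; apply: lerD.
Qed.

End StepIntegral.

Section PathLaw.
Variables (R : realType) (D : nat) (xi : 'M[R]_D -> R).
Hypothesis xi_smooth : smooth xi.
Local Notation K := (Kxi xi).
Local Notation BMat := (g_sigma_algebraType (@frob_open R D)).
Local Notation leb := (@lebesgue_measure R).

Lemma path_law_integral (mu : Prob R D) (p : R -> 'M[R]_D) (chi : Mat R D -> R) :
  path_right_continuous p -> (forall u, 0 <= u < 1 -> K (p u)) ->
  (forall A : set BMat, measurable A -> mu A = leb [set u | 0 <= u < 1 /\ A (p u)]) ->
  measurable_fun setT (chi : BMat -> R) -> (exists C, forall x, K x -> `|chi x| <= C) ->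
  intK xi mu chi = Rintegral leb `[0, 1[%classic (chi \o p).
Proof.
move=> p_rc pK mup mchi [C chiC].
pose I : set (measurableTypeR R) := `[0, 1[%classic.
have mI : measurable I by exact: measurable_itv.
(* The value [x0 xi] outside [I] keeps [p'] in [K] everywhere, so the preimage of [K] is the whole
   line; the complement of [I] is null for the restricted measure [m]. *)
pose p' (u : measurableTypeR R) : BMat := if u \in I then p u else x0 xi.
have p'E u : I u -> p' u = p u by move=> Iu; rewrite /p' mem_set.
have p'E01 u : 0 <= u < 1 -> p' u = p u.
  by move=> u01; apply: p'E; rewrite /I /= in_itv.
have mp : measurable_fun setT p'.
  rewrite -(setUv I); apply/measurable_funU => //; first exact: measurableC.
  split; first by apply: (@eq_measurable_fun _ _ (measurableTypeR R) BMat I p) (measurable_path p_rc) => u /set_mem Iu; rewrite p'E.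
  apply: (@eq_measurable_fun _ _ (measurableTypeR R) BMat _ (fun=> x0 xi)) => [u /set_mem nIu|]; last exact: measurable_cst.
  by rewrite /p' memNset.
have p'K u : K (p' u).
  rewrite /p'; case: ifPn => [/set_mem|_]; last exact: Kxi_x0.
  by rewrite /I /= in_itv /=; exact: pK.
pose m := mrestr leb mI.
have mT : (m setT < +oo)%E.
  by rewrite /m /mrestr setTI /= lebesgue_measure_itv /= lte_fin ltr01 -EFinB ltry.
have intm : m.-integrable setT (EFin \o (chi \o p')).
  apply: measurable_bounded_integrable => //; first exact: measurableT_comp.
  exists C; split; first exact: num_real.
  by move=> M CM u _; apply: le_trans (chiC _ (p'K u)) (ltW CM).
have K1 : p' @^-1` K = setT by apply/seteqP; split=> // u _; exact: p'K.
congr fine.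
transitivity (\int[pushforward m p']_(x in K) (chi x)%:E)%E.
  apply: eq_measure_integral => A mA AK.
  apply: (eq_trans (mup A mA)); rewrite /pushforward /m /mrestr /=.
  congr (leb _); apply/seteqP; split=> u; rewrite /I /= in_itv /=.
    by move=> [u01 Au]; split=> //; rewrite p'E01.
  by move=> [Au u01]; split=> //; move: Au; rewrite p'E01.
rewrite integral_pushforward//; last 3 first.
- exact/measurable_EFinP.
- by rewrite K1.
- exact: measurable_Kxi.
rewrite K1; have m0 : m (~` I) = 0%E by rewrite /m /mrestr setICl measure0.
have /= HN := negligible_integral (measurableC mI) _ intm m0.
rewrite HN//.
rewrite setTD setCK.
transitivity (\int[leb]_(x in I) (chi (p' x))%:E)%E.
  apply: eq_measure_integral => A mA AI; rewrite /m /mrestr.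
  by congr (leb _); apply/setIidPl.
by apply: eq_integral => u /set_mem Iu; rewrite /= p'E.
Qed.

End PathLaw.

(** * The dual distance and empirical laws on a chain *)

Section DistM.
Variables (R : realType) (D : nat) (xi : 'M[R]_D -> R).
Implicit Types F G : (Mat R D -> R) -> R.

(** Boundedness on the unit ball makes the [sup] in [distM] a true least upper bound instead of a
    default value. *)
Definition Lle1_bounded_functional F := exists B, forall chi, Lle1 xi chi -> `|F chi| <= B.

Lemma distM_le F G (c : R) : (forall chi, Lle1 xi chi -> F chi - G chi <= c) ->
  distM xi F G <= c.
Proof.
move=> H; apply: ge_sup; last by move=> _ [chi [L ->]]; exact: H.
exists (F (fun=> 0) - G (fun=> 0)), (fun=> 0); split=> //.
by apply: Lle1_cst; rewrite normr0.
Qed.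

Lemma distM_ge F G chi : Lle1_bounded_functional F -> Lle1_bounded_functional G ->
  Lle1 xi chi -> F chi - G chi <= distM xi F G.
Proof.
move=> [B FB] [B' GB] L; apply: ub_le_sup; last by exists chi.
exists (B + B') => _ [f [Lf ->]]; apply: le_trans (ler_norm _) _.
by apply: le_trans (ler_normB _ _) _; apply: lerD; [exact: FB|exact: GB].
Qed.

End DistM.

Section EmpiricalMeasure.
Variables (R : realType) (D : nat) (xi : 'M[R]_D -> R).
Hypothesis xi_smooth : smooth xi.
Local Notation K := (Kxi xi).
Local Notation BMat := (g_sigma_algebraType (@frob_open R D)).
Local Notation leb := (@lebesgue_measure R).

(** Indices may repeat in [s], so multiplicities encode rational weights and concatenation encodes
    mixtures. [(size s).-1.+1] is [size s] when [s] is non-empty. *)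
Definition emp (x : nat -> 'M[R]_D) (s : seq nat) : Prob R D :=
  pavg (fun i : 'I_(size s).-1.+1 => @dirac _ BMat (x (nth 0%N s i)) R : probability BMat R).

Lemma big_nth_ord (s : seq nat) (g : nat -> R) : (0 < size s)%N ->
  \sum_(i < (size s).-1.+1) g (nth 0%N s i) = \sum_(k <- s) g k.
Proof. by move=> s0; rewrite prednK// (big_nth 0%N) big_mkord. Qed.

Lemma empE x s (A : set BMat) : (0 < size s)%N ->
  emp x s A = ((size s)%:R^-1 * \sum_(k <- s) (x k \in A)%:R)%:E.
Proof.
move=> s0; rewrite /emp -[LHS]/(pavg _ A) pavgE.
rewrite (eq_bigr (fun i : 'I_(size s).-1.+1 => ((x (nth 0%N s i) \in A)%:R)%:E)) => [|i _];
  last exact: diracE.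
by rewrite sumEFin -EFinM (big_nth_ord (fun k => (x k \in A)%:R))// prednK.
Qed.

Lemma emp_intK x s chi : (0 < size s)%N -> (forall k, K (x k)) -> bounded_mfun xi chi ->
  intK xi (emp x s) chi = (size s)%:R^-1 * \sum_(k <- s) chi (x k).
Proof.
move=> s0 xK [mchi bchi].
rewrite /intK Rintegral_pavg//; last exact: measurable_Kxi.
rewrite -(big_nth_ord (fun k => chi (x k)))//.
have -> : (size s)%:R = (size s).-1.+1%:R :> R by rewrite prednK.
congr (_ * _).
apply: eq_bigr => i _; rewrite integral_dirac//.
- by rewrite diracE mem_set// mul1e.
- exact: measurable_Kxi.
- exact/measurable_EFinP.
Qed.

Definition psd_chain (y : nat -> 'M[R]_D) :=
  (forall k, psd_ball (y k)) /\ forall i j, (i <= j)%N -> psd (y j - y i).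

Lemma grad_path_right_continuous (q : R -> 'M[R]_D) :
  path_right_continuous q -> path_right_continuous (grad xi \o q).
Proof.
move=> q_rc u u01 e e0; have [d [d0 dP]] := grad_continuous xi_smooth (q u) e0.
have [d' [d'0 d'P]] := q_rc u u01 d d0.
by exists d'; split=> // v uv vd; apply: dP; exact: d'P.
Qed.

(** Sorting [s] turns the multiset of the matrices [y k] into a non-decreasing step path with
    [size s] cells of equal length. *)
Lemma Pup_emp (y : nat -> 'M[R]_D) s : psd_chain y -> (0 < size s)%N ->
  Pup xi (emp (grad xi \o y) s).
Proof.
move=> [yB yle] s0; set N := size s; pose s' := sort leq s.
have Npos : 0 < N%:R :> R by rewrite ltr0n.
have ss' : size s' = N by rewrite size_sort.
pose z k := y (nth 0%N s' k).
pose q (u : R) := z (Num.truncn (u * N%:R)).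
have uN0 (u : R) : 0 <= u -> 0 <= u * N%:R by move=> u0; rewrite mulr_ge0// ltW.
have truncN (u : R) : 0 <= u -> (Num.truncn (u * N%:R))%:R <= u * N%:R.
  by move=> u0; rewrite truncn_le uN0.
have trN (u : R) : 0 <= u < 1 -> (Num.truncn (u * N%:R) < N)%N.
  move=> /andP[u0 u1]; rewrite -(@ltr_nat R).
  by apply: le_lt_trans (truncN _ u0) _; rewrite gtr_pMl.
have tr_eq (u : R) (k : nat) : 0 <= u -> k%:R <= u * N%:R < k.+1%:R -> Num.truncn (u * N%:R) = k.
  by move=> u0 /andP[h1 h2]; apply: truncn_def; rewrite h1 h2.
have q_rc : path_right_continuous q.
  move=> u /andP[u0 u1] e e0.
  have h := truncnS_gt (u * N%:R); set k := Num.truncn _ in h.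
  exists (k.+1%:R / N%:R - u); split; first by rewrite subr_gt0 ltr_pdivlMr.
  move=> v /andP[uv v1]; rewrite addrC subrK ltr_pdivlMr// => vk.
  rewrite /q (tr_eq v k) ?(le_trans u0 uv)//; last first.
    by rewrite vk andbT; apply: le_trans (truncN _ u0) _; rewrite ler_pM2r.
  by rewrite subrr frob0.
have p_rc := grad_path_right_continuous q_rc.
exists q; split; first by move=> u _; exact: yB.
split.
  move=> u v u0 uv v1; apply: yle; apply: sorted_leq_nth => //.
  - exact: leq_trans.
  - by apply: sort_sorted; exact: leq_total.
  - by rewrite inE ss'; apply: trN; rewrite u0 (le_lt_trans uv v1).
  - by rewrite inE ss'; apply: trN; rewrite (le_trans u0 uv) v1.
  - by apply: le_truncn; rewrite ler_pM2r.
split; first exact: q_rc.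
split.
  move=> u /andP[u0 u1].
  (* At a grid point the left limit is the value on the preceding cell, hence a cell that is open on
     the left and closed on the right. *)
  have [m /andP[m1 m2]] : exists m : nat, m%:R < u * N%:R <= m.+1%:R.
    have h1 := truncN _ (ltW u0); have h2 := truncnS_gt (u * N%:R).
    case: (Num.truncn _) h1 h2 => [|k] h1 h2.
      by exists 0%N; rewrite (ltW h2) andbT mulr_gt0.
    move: h1; rewrite le_eqVlt => /predU1P[E|h1]; last by exists k.+1; rewrite h1 ltW.
    by exists k; rewrite -E lexx andbT ltr_nat.
  exists (z m) => e e0; exists (u - m%:R / N%:R); split.
    by rewrite subr_gt0 ltr_pdivrMr.
  move=> v /andP[v0 vu]; rewrite subKr ltr_pdivrMr// => mv.
  rewrite /q (tr_eq v m)// ?subrr ?frob0// (ltW mv)/=.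
  by apply: lt_le_trans m2; rewrite ltr_pM2r.
move=> A mA; rewrite empE// -/N.
pose I : set (measurableTypeR R) := `[0, 1[%classic.
have mI : measurable I by exact: measurable_itv.
pose E : set (measurableTypeR R) := I `&` (grad xi \o q) @^-1` A.
have mE : measurable E by exact: (measurable_path p_rc).
have -> : [set u : R | 0 <= u < 1 /\ A (grad xi (q u))] = E.
  by apply/seteqP; split=> u; rewrite /E /I /= in_itv.
have EI : leb E = (\int[leb]_(u in I) (\1_E u)%:E)%E.
  by rewrite integral_indic// /E setIAC setIid.
have finE : leb E \is a fin_num.
  rewrite ge0_fin_numE//; apply: (@le_lt_trans _ _ (leb I)).
    by apply: le_measure; rewrite ?inE//; exact: subIsetl.
  by rewrite /= lebesgue_measure_itv /= lte_fin ltr01 -EFinB ltry.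
rewrite -[RHS]fineK//; congr EFin; rewrite EI.
have mf : measurable_fun I (\1_E : measurableTypeR R -> R) by exact: measurable_indic.
have fC (u : R) : 0 <= u < 1 -> `|(\1_E : R -> R) u| <= 1.
  by move=> _; rewrite indicE ger0_norm ?ler0n// lern1 leq_b1.
pose c k : R := (grad xi (z k) \in A)%:R.
(* With error 0 in every cell, the step approximation is an exact formula for the measure of [E]. *)
have H : (forall k (u : R), (k < N)%N -> k%:R / N%:R <= u < k.+1%:R / N%:R ->
    `|(\1_E : R -> R) u - c k| <= 0) ->
    `|Rintegral leb I (\1_E : R -> R) - N%:R^-1 * \sum_(k < N) c k| <= 0.
  move=> h; have := @step_integral R \1_E 1 mf fC c (fun=> 0) N s0 h.
  by rewrite [X in _ <= _ * X]big1// mulr0.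
apply/esym/eqP; rewrite -subr_eq0 -normr_le0.
have -> : \sum_(k <- s) ((grad xi \o y) k \in A)%:R = \sum_(k < N) c k :> R.
  rewrite -(perm_big _ (introT permPl (perm_sort leq s))) /= (big_nth 0%N) big_mkord.
  by rewrite -/s' ss'.
apply: H => k u kN /andP[h1 h2]; rewrite ler_pdivrMr// in h1; rewrite ltr_pdivlMr// in h2.
have u0 : 0 <= u by rewrite -(pmulr_lge0 _ Npos); apply: le_trans h1.
have u1 : u < 1.
  rewrite -(ltr_pM2r Npos) mul1r; apply: lt_le_trans h2 _.
  by rewrite ler_nat.
have -> : (\1_E : R -> R) u = c k.
  rewrite indicE; congr (_%:R); congr (nat_of_bool _).
  have qk : q u = z k by rewrite /q (tr_eq u k)// h1 h2.
  apply/idP/idP => [/set_mem[_ /=]|/set_mem h]; rewrite ?qk; first exact: mem_set.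
  by apply/mem_set; split; [rewrite /I /= in_itv /= u0|rewrite /= qk].
by rewrite subrr normr0.
Qed.

End EmpiricalMeasure.

(** * Quantization of monotone paths and Jensen's inequality on a chain *)

Section PathMeasures.
Variables (R : realType) (D : nat) (xi : 'M[R]_D -> R).
Hypothesis xi_smooth : smooth xi.
Local Notation K := (Kxi xi).
Local Notation BMat := (g_sigma_algebraType (@frob_open R D)).
Local Notation leb := (@lebesgue_measure R).

Lemma Pup_K (mu : Prob R D) : Pup xi mu -> mu K = 1%E.
Proof.
move=> [q [qB [_ [_ [_ qmu]]]]]; rewrite qmu; last exact: measurable_Kxi.
have -> : [set u : R | 0 <= u < 1 /\ K (grad xi (q u))] = `[0, 1[%classic.
  apply/seteqP; split=> u; rewrite /= in_itv /=; first by case.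
  by move=> u01; split=> //; exists (q u) => //; exact: qB.
by rewrite lebesgue_measure_itv /= lte_fin ltr01 oppr0 adde0.
Qed.

Lemma psd_ball_tr_le (A : 'M[R]_D) : psd_ball A -> \tr A <= D%:R.
Proof.
by move=> [_ A1]; apply: le_trans (tr_le_frob _) _; rewrite ler_piMr.
Qed.

(* The trace controls the total variation of a monotone path, so the quantization
   error is uniform over the whole of [Pup]. *)
Lemma Pup_quantization (e : R) : 0 < e -> exists N, (0 < N)%N /\
  forall mu, Pup xi mu -> exists y : nat -> 'M[R]_D, psd_chain y /\
    forall chi, Lle1 xi chi ->
      `|intK xi mu chi - N%:R^-1 * \sum_(k < N) chi (grad xi (y k))| <= e.
Proof.
move=> e0; have e2 : 0 < e / 2 by lra.
have [C [C0 CP]] := grad_modulus xi_smooth e2.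
(* The factors come from the modulus of the gradient, from the comparison of norm and trace on the
   cone, and from the bound [D%:R] on the trace in the ball. *)
pose c := C * (D ^ 2)%:R * D%:R.
have c0 : 0 <= c by rewrite !mulr_ge0.
pose N := (Num.truncn (2 * c / e)).+1; exists N; split=> //.
have Npos : 0 < N%:R :> R by rewrite ltr0n.
have cN : c / N%:R <= e / 2.
  rewrite ler_pdivrMr//; have := truncnS_gt (2 * c / e); rewrite ltr_pdivrMr// -/N => h; lra.
move=> mu [q [qB [q_le [q_rc [_ qmu]]]]].
pose g (k : nat) : R := k%:R / N%:R.
have g01 k : (k < N)%N -> 0 <= g k < 1.
  by move=> kN; rewrite divr_ge0//= ltr_pdivrMr// mul1r ltr_nat.
have minN k : (minn k N.-1 < N)%N by rewrite /N /= ltnS geq_minr.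
(* Indices beyond the last cell repeat its value, because a chain is indexed by all of [nat]. *)
pose y k := q (g (minn k N.-1)).
have yE k : (k < N)%N -> y k = q (g k).
  by move=> kN; rewrite /y (minn_idPl _)// -ltnS.
have yB k : psd_ball (y k) by apply: qB; exact: g01.
exists y; split.
  split=> // i j ij; apply: q_le; first by case/andP: (g01 _ (minN i)).
    by rewrite /g ler_pM2r ?invr_gt0// ler_nat; clear -ij; lia.
  by case/andP: (g01 _ (minN j)).
move=> chi L; have [chi' [chi'L chi'E]] := Lle1_extension xi_smooth L.
have pK (u : R) : 0 <= u < 1 -> K (grad xi (q u)) by move=> u01; exists (q u) => //; exact: qB.
have p_rc := grad_path_right_continuous xi_smooth q_rc.
have chi'1 u v : `|chi' u - chi' v| <= 1 * frob (u - v) by rewrite mul1r.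
have mchi' := lip_measurable chi'1.
have [_ [B BP]] := bounded_mfun_lip xi_smooth chi'1.
have -> : intK xi mu chi = intK xi mu chi' by apply: eq_intK => x /chi'E.
rewrite (path_law_integral xi_smooth p_rc pK qmu mchi'); last by exists B.
have -> : \sum_(k < N) chi (grad xi (y k)) = \sum_(k < N) chi' (grad xi (y k)).
  by apply: eq_bigr => k _; rewrite chi'E//; exists (y k) => //; exact: yB.
(* The path has no value at 1. [D%:R] bounds every trace in the ball and stands in for it, so that
   the last cell is treated like the others. *)
pose t (k : nat) : R := if (k < N)%N then \tr (q (g k)) else D%:R.
pose err (k : nat) : R := e / 2 + C * (D ^ 2)%:R * (t k.+1 - t k).
have mf : measurable_fun (`[0, 1[%classic : set (measurableTypeR R))
    ((chi' \o (grad xi \o q)) : measurableTypeR R -> R).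
  exact: (measurableT_comp mchi' (measurable_path p_rc)).
have fB (u : R) : 0 <= u < 1 -> `|(chi' \o (grad xi \o q)) u| <= B.
  by move=> u01; apply: BP; exact: pK.
have Hk k (u : R) : (k < N)%N -> k%:R / N%:R <= u < k.+1%:R / N%:R ->
    `|(chi' \o (grad xi \o q)) u - chi' (grad xi (y k))| <= err k.
  move=> kN /andP[ku uk].
  have u0 : 0 <= u by apply: le_trans ku; rewrite divr_ge0.
  have u1 : u < 1.
    apply: lt_le_trans uk _; rewrite ler_pdivrMr// mul1r ler_nat.
    exact: kN.
  have u01 : 0 <= u < 1 by rewrite u0 u1.
  apply: le_trans (chi'L _ _) _; apply: le_trans (CP _ _ (qB u u01) (yB k)) _.
  rewrite /err lerD2l -mulrA ler_wpM2l// yE//.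
  have psd_d : psd (q u - q (g k)).
    by apply: q_le => //; rewrite /g divr_ge0.
  apply: le_trans (psd_frob_le_tr psd_d) _; rewrite ler_wpM2l// raddfB /= {2}/t kN lerD2r.
  rewrite /t; case: ifPn => k1; last by apply: psd_ball_tr_le; exact: qB.
  rewrite -subr_ge0 -raddfB /=; apply: psd_tr_ge0; apply: q_le => //; first exact: ltW.
  by case/andP: (g01 _ k1).
have H := step_integral (c := fun k => chi' (grad xi (y k))) mf fB (isT : (0 < N)%N) Hk.
have Eerr : \sum_(k < N) err k = N%:R * (e / 2) + C * (D ^ 2)%:R * (t N - t 0%N).
  rewrite big_split /= sumr_const card_ord mulr_natl; congr (_ + _).
  rewrite -mulr_sumr; congr (_ * _).
  by rewrite -(big_mkord xpredT (fun k => t k.+1 - t k)) telescope_sumr.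
apply: le_trans H _; rewrite Eerr [leLHS]mulrDr mulKf ?gt_eqF//.
have tN : t N - t 0%N <= D%:R.
  rewrite /t ltnn /N /= -/N lerBlDr lerDl; apply: psd_tr_ge0.
  by have [] : psd_ball (q (g 0%N)) by apply: qB; exact: g01.
have : N%:R^-1 * (C * (D ^ 2)%:R * (t N - t 0%N)) <= N%:R^-1 * c.
  by rewrite ler_pM2l ?invr_gt0// ler_wpM2l// mulr_ge0.
rewrite mulrC in cN; lra.
Qed.

Lemma intK_bounded : exists C : R, 0 <= C /\
  forall (mu : Prob R D) chi, Lle1 xi chi -> `|intK xi mu chi| <= C.
Proof.
have [C [C0 CP]] := Lle1_bounded xi_smooth.
exists C; split=> // mu chi L; rewrite -[X in `|X|]subr0.
have -> : 0 = intK xi mu (fun=> 0) by rewrite intK_cst// mul0r.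
apply: (intK_dist_prob xi_smooth) => //.
- exact: bounded_mfun_Lle1.
- exact: bounded_mfun_cst.
- by move=> x Kx; rewrite subr0; exact: CP.
Qed.

Lemma embed_bounded (mu : Prob R D) : Lle1_bounded_functional xi (embed xi mu).
Proof. by have [C [_ CP]] := intK_bounded; exists C; exact: CP. Qed.

Section Jensen.
Variables (phi : Prob R D -> R).
Hypothesis phi_lip : lip1_Pup xi phi.
Hypothesis phi_pre : preconcave xi phi.

Lemma phi_le mu nu (c : R) : Pup xi mu -> Pup xi nu ->
  (forall chi, Lle1 xi chi -> intK xi mu chi - intK xi nu chi <= c) ->
  phi mu <= phi nu + c.
Proof.
move=> Pmu Pnu H; have := phi_lip Pmu Pnu.
have : dP xi mu nu <= c by exact: distM_le.
rewrite ler_norml => h /andP[_ h2]; lra.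
Qed.

(** All lists index the same chain, so every concatenation is again in [Pup] and pre-concavity can
    be applied one list at a time. Equal lengths make the weight of the first list the inverse of
    the number of lists. *)
Lemma jensen_emp (y : nat -> 'M[R]_D) (N : nat) (ss : seq (seq nat)) : psd_chain y -> (0 < N)%N ->
  (forall s, s \in ss -> size s = N) -> (0 < size ss)%N ->
  \sum_(s <- ss) phi (emp (grad xi \o y) s) <=
    (size ss)%:R * phi (emp (grad xi \o y) (flatten ss)).
Proof.
move=> yc N0; elim: ss => // s [|s' ss] IH sN _.
  by rewrite big_seq1 /= cats0 mul1r.
have {}IH := IH (fun s2 h => sN s2 (mem_behead (s := s :: s' :: ss) h)) isT.
rewrite big_cons; set t := s' :: ss in IH sN *.
have st : size s = N by apply: sN; rewrite inE eqxx.
have sft : size (flatten t) = (size t * N)%N.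
  have: forall s2, s2 \in t -> size s2 = N by move=> s2 h; apply: sN; rewrite inE h orbT.
  elim: t {IH sN} => //= a t IHt H.
  rewrite size_cat H ?inE ?eqxx// IHt// => s2 h; by apply: H; rewrite inE h orbT.
have m0 : (0 < size t)%N by [].
rewrite -[flatten (s :: t)]/(s ++ flatten t) -[size (s :: t)]/(size t).+1.
clearbody t.
have ft0 : (0 < size (flatten t))%N by rewrite sft muln_gt0 m0.
have s0 : (0 < size s)%N by rewrite st.
pose l : R := (size t).+1%:R^-1.
have M0 : 0 < (size t).+1%:R :> R by rewrite ltr0n.
have alg (n m S1 S2 : R) : 0 < n -> 0 < m -> (n + m * n)^-1 * (S1 + S2) =
    (m + 1)^-1 * (n^-1 * S1) + (1 - (m + 1)^-1) * ((m * n)^-1 * S2).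
  move=> n0 mp; have -> : n + m * n = (m + 1) * n by ring.
  field; rewrite !gt_eqF//; lra.
have l01 : 0 <= l <= 1 by rewrite invr_ge0 ltW//= invf_le1// ler1n.
have sft0 : (0 < size (s ++ flatten t))%N by rewrite size_cat st ltn_addr.
have := @phi_pre (emp (grad xi \o y) s) (emp (grad xi \o y) (flatten t))
  (emp (grad xi \o y) (s ++ flatten t)) l (Pup_emp xi_smooth yc s0)
  (Pup_emp xi_smooth yc ft0) l01.
move=> H; have {}H : l * phi (emp (grad xi \o y) s) +
    (1 - l) * phi (emp (grad xi \o y) (flatten t)) <= phi (emp (grad xi \o y) (s ++ flatten t)).
  apply: H; last exact: Pup_emp.
  move=> A mA; rewrite !empE// -!EFinM -EFinD; congr EFin.
  rewrite big_cat size_cat sft st /l /= natrD natrM -[(size t).+1%:R]natr1.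
  by apply: alg; rewrite ltr0n.
have {}H : (size t).+1%:R * (l * phi (emp (grad xi \o y) s) +
    (1 - l) * phi (emp (grad xi \o y) (flatten t))) <=
    (size t).+1%:R * phi (emp (grad xi \o y) (s ++ flatten t)).
  by rewrite ler_pM2l.
apply: le_trans H; rewrite mulrDr mulrA /l mulfV ?gt_eqF// mul1r lerD2l mulrA mulrBr mulr1.
by rewrite mulfV ?gt_eqF// -natr1 addrK.
Qed.

End Jensen.
End PathMeasures.

(** * Jensen's inequality for finite averages *)

Section FiniteJensen.
Variables (R : realType) (D : nat) (xi : 'M[R]_D -> R).
Hypothesis xi_smooth : smooth xi.
Local Notation BMat := (g_sigma_algebraType (@frob_open R D)).
Variables (phi : Prob R D -> R).
Hypothesis phi_lip : lip1_Pup xi phi.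
Hypothesis phi_pre : preconcave xi phi.

Definition avg (M : nat) (nu : 'I_M.+1 -> Prob R D) : Prob R D := pavg nu.

Lemma intK_avg M (nu : 'I_M.+1 -> Prob R D) chi : bounded_mfun xi chi ->
  intK xi (avg nu) chi = M.+1%:R^-1 * \sum_i intK xi (nu i) chi.
Proof.
by move=> [mchi bchi]; apply: Rintegral_pavg => //; exact: measurable_Kxi.
Qed.

(* The discretized mean of the [nu i] is transported onto the discretized [mu]
   by an optimal permutation; it moves each [nu i] to a law [nu' i] carried by the
   chain of [mu], and pre-concavity applies to the average of the [nu' i]. *)
Lemma jensen_avg M (nu : 'I_M.+1 -> Prob R D) (mu : Prob R D) :
  (forall i, Pup xi (nu i)) -> Pup xi mu ->
  M.+1%:R^-1 * \sum_i phi (nu i) <= phi mu + distM xi (embed xi (avg nu)) (embed xi mu).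
Proof.
move=> Pnu Pmu; apply/ler_addgt0Pl => e e0.
have e4 : 0 < e / 4 by lra.
have [N [N0 HN]] := Pup_quantization xi_smooth e4.
have [y [yc yP]] := HN mu Pmu.
have /choice[x xP] : forall i, exists x : nat -> 'M[R]_D, psd_chain x /\
    forall chi, Lle1 xi chi ->
      `|intK xi (nu i) chi - N%:R^-1 * \sum_(k < N) chi (grad xi (x k))| <= e / 4.
  by move=> i; exact: HN.
pose J := ('I_M.+1 * 'I_N)%type.
have [chi0 [s [chi0L opt]]] := @assignment_duality R D J (ord0, Ordinal N0)
  (fun j => grad xi (x j.1 j.2)) (fun j => grad xi (y j.2)).
(* Normalized at [x0] to lie in the unit ball; the constant cancels because [opt] compares two sums
   over the same [J]. *)
pose chi := fun z => chi0 z - chi0 (x0 xi).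
have L : Lle1 xi chi.
  split; first by rewrite /chi subrr normr0.
  by move=> u v _ _; rewrite mul1r /chi opprB addrA subrK.
(* The targets of the [N] atoms that discretize [nu i]: the empirical law of [ix i] is the
   transported law. *)
pose ix i := [seq val (s (i, k)).2 | k <- enum 'I_N].
have ix_size i : size (ix i) = N by rewrite size_map size_enum_ord.
have ix_sum i (g : nat -> R) : \sum_(k <- ix i) g k = \sum_(k < N) g (s (i, k)).2.
  by rewrite big_map big_enum.
pose ss := [seq ix i | i <- enum 'I_M.+1].
have ss_size : size ss = M.+1 by rewrite size_map size_enum_ord.
have ss_sizes t : t \in ss -> size t = N by move=> /mapP[i _ ->].
have ss_sum (g : seq nat -> R) : \sum_(t <- ss) g t = \sum_i g (ix i).
  by rewrite big_map big_enum.
(* [s] permutes [J], so every index below [N] occurs exactly [M.+1] times in the concatenation,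
   which therefore represents the discretized [mu]. *)
have fl_sum (g : nat -> R) : \sum_(k <- flatten ss) g k = M.+1%:R * \sum_(k < N) g k.
  rewrite big_flatten /= ss_sum /=; under eq_bigr do rewrite ix_sum.
  have -> : \sum_i \sum_(k < N) g (s (i, k)).2 = \sum_(j : J) g (s j).2.
    by rewrite pair_big /=; apply: eq_bigr => -[].
  have -> : \sum_(j : J) g (s j).2 = \sum_(j : J) g j.2.
    by rewrite [RHS](reindex_inj (@perm_inj _ s)).
  have -> : \sum_(j : J) g j.2 = \sum_(i < M.+1) \sum_(k < N) g k by rewrite pair_big.
  by rewrite sumr_const card_ord mulr_natl.
have fl_size : size (flatten ss) = (M.+1 * N)%N.
  apply/eqP; rewrite -(eqr_nat R) -sum1_size natr_sum fl_sum.
  by rewrite sumr_const card_ord natrM.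
have N0R : 0 < N%:R :> R by rewrite ltr0n.
have M0R : 0 < M.+1%:R :> R by rewrite ltr0n.
have yK k : Kxi xi (grad xi (y k)) by exists (y k) => //; exact: yc.1.
pose p := grad xi \o y.
have int_fl g : Lle1 xi g ->
    intK xi (emp p (flatten ss)) g = N%:R^-1 * \sum_(k < N) g (grad xi (y k)).
  move=> Lg; rewrite emp_intK//; last by apply: bounded_mfun_Lle1.
    rewrite fl_sum fl_size natrM; move: (\sum_(k < N) _) => S.
    by field; rewrite !gt_eqF.
  by rewrite fl_size muln_gt0 N0.
have Pfl : Pup xi (emp p (flatten ss)).
  by apply: Pup_emp => //; rewrite fl_size muln_gt0 N0.
have Pix i : Pup xi (emp p (ix i)) by apply: Pup_emp => //; rewrite ix_size.
(* Matching each atom of [nu i] with its target bounds the distance between the two laws; [e / 4]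
   pays for the quantization of [nu i]. *)
have step1 i : phi (nu i) <= phi (emp p (ix i)) +
    (e / 4 + N%:R^-1 * \sum_(k < N) frob (grad xi (x i k) - grad xi (y (s (i, k)).2))).
  apply: (phi_le phi_lip) => // g Lg.
  rewrite emp_intK ?ix_size//; last by apply: bounded_mfun_Lle1.
  rewrite (ix_sum i (fun k => g (p k))).
  have := (xP i).2 g Lg; rewrite ler_norml => /andP[_ h2].
  have alg (a b c d f : R) : a - b <= c -> d - a <= f -> d - b <= f + c by lra.
  apply: alg h2.
  rewrite -mulrBr ler_pM2l ?invr_gt0// -sumrB; apply: ler_sum => k _.
  apply: le_trans (ler_norm _) _; rewrite -[leRHS]mul1r; apply: Lg.2; last exact: yK.
  by exists (x i k) => //; exact: (xP i).1.1.
have step2 : \sum_i phi (emp p (ix i)) <= M.+1%:R * phi (emp p (flatten ss)).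
  have := jensen_emp xi_smooth phi_pre yc N0 ss_sizes.
  by rewrite ss_size ss_sum; apply.
have step3 : phi (emp p (flatten ss)) <= phi mu + e / 4.
  apply: (phi_le phi_lip) => // f Lf; rewrite int_fl//.
  by have := yP f Lf; rewrite ler_norml => /andP[h _]; lra.
(* The shares of all [nu i] add up to the optimal cost, which the potential turns back into
   integrals; the quantizations of the [nu i] and of [mu] cost [e / 4] each. *)
have step4 : N%:R^-1 * \sum_(j : J) frob (grad xi (x j.1 j.2) - grad xi (y (s j).2)) <=
    \sum_i intK xi (nu i) chi - M.+1%:R * intK xi mu chi + M.+1%:R * (e / 2).
  apply: le_trans (_ : N%:R^-1 * (\sum_(j : J) chi (grad xi (x j.1 j.2)) -
      \sum_(j : J) chi (grad xi (y j.2))) <= _).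
    rewrite ler_pM2l ?invr_gt0//; apply: le_trans opt _.
    by rewrite !sumrB opprB addrA subrK.
  have -> : \sum_(j : J) chi (grad xi (x j.1 j.2)) =
      \sum_(i < M.+1) \sum_(k < N) chi (grad xi (x i k)) by rewrite pair_big.
  have -> : \sum_(j : J) chi (grad xi (y j.2)) =
      \sum_(i < M.+1) \sum_(k < N) chi (grad xi (y k)) by rewrite pair_big.
  rewrite mulrBr sumr_const card_ord -[_ *+ M.+1]mulr_natl mulrCA mulr_sumr.
  have h1 : \sum_(i < M.+1) (N%:R^-1 * \sum_(k < N) chi (grad xi (x i k))) <=
      \sum_i (intK xi (nu i) chi + e / 4).
    apply: ler_sum => l _; have := (xP l).2 chi L; rewrite ler_norml => /andP[h _].
    have alg (a d f : R) : - f <= d - a -> a <= d + f by lra.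
    exact: alg h.
  rewrite big_split /= sumr_const card_ord -[_ *+ M.+1]mulr_natl in h1.
  have h2 : M.+1%:R * intK xi mu chi <= M.+1%:R * (N%:R^-1 * \sum_(k < N) chi (grad xi (y k)) + e / 4).
    rewrite ler_pM2l//; have := yP chi L; rewrite ler_norml => /andP[_ h].
    have alg (a d f : R) : d - a <= f -> d <= a + f by lra.
    exact: alg h.
  have alg (a b c d f m : R) : a <= c + m * f -> m * d <= m * (b + f) ->
    a - m * b <= c - m * d + m * (f + f) by lra.
  have -> : e / 2 = e / 4 + e / 4 by lra.
  exact: alg h1 h2.
have step5 : \sum_i intK xi (nu i) chi - M.+1%:R * intK xi mu chi <=
    M.+1%:R * distM xi (embed xi (avg nu)) (embed xi mu).
  have := distM_ge (embed_bounded xi_smooth (avg nu)) (embed_bounded xi_smooth mu) L.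
  rewrite /embed intK_avg; last by apply: bounded_mfun_Lle1.
  rewrite -(ler_pM2l M0R) mulrBr mulrA mulfV ?gt_eqF// mul1r.
  exact.
rewrite ler_pdivrMl//.
apply: le_trans (ler_sum _ (fun i _ => step1 i)) _.
rewrite big_split /= big_split /= sumr_const card_ord -[_ *+ M.+1]mulr_natl -mulr_sumr.
rewrite (pair_big xpredT xpredT
  (fun (i : 'I_M.+1) (k : 'I_N) => frob (grad xi (x i k) - grad xi (y (s (i, k)).2)))) /=.
have -> : \sum_(q : J) frob (grad xi (x q.1 q.2) - grad xi (y (s (q.1, q.2)).2)) =
   \sum_(j : J) frob (grad xi (x j.1 j.2) - grad xi (y (s j).2)).
  by apply: eq_bigr => -[].
have step3' : M.+1%:R * phi (emp p (flatten ss)) <= M.+1%:R * (phi mu + e / 4) by rewrite ler_pM2l.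
have alg (m a1 a2 a3 a4 a5 a6 a7 : R) : a1 <= m * a2 -> m * a2 <= m * (a3 + e / 4) ->
    a4 <= a5 - m * a6 + m * (e / 2) -> a5 - m * a6 <= m * a7 ->
    a1 + (m * (e / 4) + a4) <= m * (e + (a3 + a7)) by lra.
exact: alg step2 step3' step4 step5.
Qed.

End FiniteJensen.

(** * Measurability on the set of path laws *)

Section MeasurabilityOnPup.
Variables (R : realType) (D : nat) (xi : 'M[R]_D -> R).
Hypothesis xi_smooth : smooth xi.
Local Notation K := (Kxi xi).
Local Notation BMat := (g_sigma_algebraType (@frob_open R D)).
Local Notation BProb := (g_sigma_algebraType (@Pup_open R D xi)).

Lemma measurable_Pup : measurable (Pup xi : set BProb).
Proof.
apply: sub_sigma_algebra; split=> // mu Pmu; exists 1; split=> //.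
Qed.

Lemma dP_ge0 (mu nu : Prob R D) : 0 <= dP xi mu nu.
Proof.
have L0 : Lle1 xi (fun=> 0) by apply: Lle1_cst; rewrite normr0.
have := distM_ge (embed_bounded xi_smooth mu) (embed_bounded xi_smooth nu) L0.
by rewrite /embed !intK_cst// !mul0r subrr.
Qed.

Lemma intK_Pup_cst (mu : Prob R D) (c : R) : Pup xi mu -> intK xi mu (fun=> c) = c.
Proof.
move=> Pmu; transitivity (c * fine (mu K)); first exact: intK_cst.
by rewrite Pup_K// mulr1.
Qed.

Lemma measurable_dP_lip (f : Prob R D -> R) (L : R) :
  (forall mu nu, Pup xi mu -> Pup xi nu -> `|f mu - f nu| <= L * dP xi mu nu) ->
  measurable_fun (Pup xi : set BProb) (f : BProb -> R).
Proof.
move=> fL; apply: (measurability _ (RGenOInfty.measurableE R)) => //= _ [_ [r ->] <-].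
apply: sub_sigma_algebra; split; first by move=> mu [].
move=> mu [Pmu] /=; rewrite in_itv /= andbT => rx.
have L1 : 0 < `|L| + 1 by rewrite ltr_wpDl.
exists ((f mu - r) / (`|L| + 1)); split; first by rewrite divr_gt0// subr_gt0.
move=> nu Pnu; rewrite ltr_pdivlMr// => mn; split=> //=; rewrite in_itv /= andbT.
have := fL mu nu Pmu Pnu; rewrite ler_norml => /andP[_ h].
have : L * dP xi mu nu <= dP xi mu nu * (`|L| + 1).
  rewrite mulrC ler_wpM2l ?dP_ge0//.
  by apply: le_trans (ler_norm _) _; rewrite lerDl.
move: (dP xi mu nu) h mn => a h mn; lra.
Qed.

(** Dividing by [L] and subtracting the value at [x0] puts [f] in the unit ball; the constant
    cancels because both laws give [K] mass 1. The sign [s] supplies both directions, since [dP] is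
    a supremum without absolute value. *)
Lemma intK_dP_lip (f : Mat R D -> R) (L : R) : 0 < L ->
  (forall x y, `|f x - f y| <= L * frob (x - y)) ->
  forall mu nu, Pup xi mu -> Pup xi nu ->
    `|intK xi mu f - intK xi nu f| <= L * dP xi mu nu.
Proof.
move=> L0 fL mu nu Pmu Pnu.
have bf := bounded_mfun_lip xi_smooth fL.
have H (s : R) : `|s| = 1 -> s * (intK xi mu f - intK xi nu f) <= L * dP xi mu nu.
  move=> s1; pose g := fun x => s / L * f x + - (s / L * f (x0 xi)).
  have gL : Lle1 xi g.
    split; first by rewrite /g subrr normr0.
    move=> x y _ _; rewrite /g opprB addrA subrK -mulrBr normrM normrM s1 !mul1r.
    by rewrite gtr0_norm ?invr_gt0// ler_pdivrMl.
  have := distM_ge (embed_bounded xi_smooth mu) (embed_bounded xi_smooth nu) gL.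
  have bsf : bounded_mfun xi (fun x => s / L * f x) by exact: bounded_mfunZ.
  rewrite /embed /g !intK_D//; try exact: bounded_mfun_cst.
  rewrite !intK_Z// !intK_Pup_cst// opprD addrACA subrr addr0.
  have alg (a b d : R) : s / L * a - s / L * b <= d -> s * (a - b) <= L * d.
    move=> h; have -> : s * (a - b) = L * (s / L * a - s / L * b) by field; rewrite gt_eqF.
    by rewrite ler_pM2l.
  exact: alg.
rewrite ler_norml; apply/andP; split.
  by rewrite lerNl -mulN1r; apply: H; rewrite normrN1.
by rewrite -[leLHS]mul1r; apply: H; rewrite normr1.
Qed.

Lemma measurable_intK_lip (f : Mat R D -> R) (L : R) : 0 < L ->
  (forall x y, `|f x - f y| <= L * frob (x - y)) ->
  measurable_fun (Pup xi : set BProb) ((fun nu => intK xi nu f) : BProb -> R).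
Proof. by move=> L0 fL; apply: (measurable_dP_lip (L := L)); exact: intK_dP_lip. Qed.

Lemma Pup_setIK (nu : Prob R D) (A : set BMat) : Pup xi nu -> measurable A ->
  nu A = nu (A `&` K).
Proof.
move=> Pnu mA; have mK := measurable_Kxi xi_smooth.
rewrite (measureDI nu mA mK) [X in (X + _)%E](_ : _ = 0%E) ?add0e//.
apply: (@subset_measure0 _ _ _ nu (A `\` K) (~` K)) => //.
- exact: measurableD.
- exact: measurableC.
- have := probability_setC nu mK; rewrite Pup_K// subee//; exact.
Qed.

(* [1_A] is the increasing limit of the Lipschitz functions min(1, n d(., A^c)). *)
Lemma measurable_evalP_open (A : set (Mat R D)) : frob_open A ->
  measurable_fun (Pup xi : set BProb) ((fun nu => evalP nu A) : BProb -> \bar R).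
Proof.
move=> oA; have mA : measurable (A : set BMat) by exact: frob_open_measurable.
(* If [A] is everything, the distance to its complement would be an infimum over the empty set, so
   this case is separate. *)
have [[y0 nAy0]|AT] := pselect (exists y, ~ A y); last first.
  have -> : A = setT.
    by apply/seteqP; split=> // x _; apply: contrapT => nAx; apply: AT; exists x.
  apply: (@eq_measurable_fun _ _ BProb (\bar R) _ (fun=> 1%E)) => [nu _|].
    by rewrite /evalP; apply/esym; exact: probability_setT.
  exact: measurable_cst.
pose I := {y | ~ A y}.
have iI : inhabited I by exists; exists y0.
have lbd (z : 'M[R]_D) : exists b : R, forall i : I, b <= 0 + frob (z - sval i).
  by exists 0 => i; rewrite add0r frob_ge0.
pose g := infconv (fun i : I => sval i) (fun=> 0 : R).
pose f (n : nat) x := Num.min 1 (n.+1%:R * g x).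
have g0 x : 0 <= g x by apply: infconv_ge => // i; rewrite add0r frob_ge0.
have fL n x y : `|f n x - f n y| <= n.+1%:R * frob (x - y).
  have h := infconv_lip lbd iI x y.
  have {}h : `|n.+1%:R * g x - n.+1%:R * g y| <= n.+1%:R * frob (x - y).
    by rewrite -mulrBr normrM ger0_norm// ler_pM2l.
  apply: le_trans h; rewrite /f; move: (_ * g x) (_ * g y) => a b.
  rewrite /Num.min; case: (ltP 1 a) => h1; case: (ltP 1 b) => h2;
    rewrite ?subrr ?normr0//; rewrite ler_norml; apply/andP;
    have := ler_norm (a - b); have := ler_norm (- (a - b)); rewrite normrN => *;
    split; lra.
have f0 n x : 0 <= f n x by rewrite le_min ler01 mulr_ge0.
have cvgf x : (f n x)%:E @[n --> \oo] --> (\1_A x)%:E.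
  apply: cvg_near_cst; rewrite indicE; have [Ax|nAx] := pselect (A x); last first.
    apply: nearW => n; rewrite memNset//= /f; have -> : g x = 0.
      apply/eqP; rewrite eq_le g0 andbT.
      by have := infconv_le lbd iI x (exist _ x nAx); rewrite /= subrr frob0 addr0.
    by rewrite mulr0 /Num.min ltr10.
  have [e [e0 eA]] := oA x Ax.
  have gx : e <= g x.
    apply: infconv_ge => // -[y nAy] /=; rewrite add0r leNgt; apply/negP => h.
    by apply: nAy; apply: eA; rewrite frobC.
  exists (Num.truncn e^-1) => // n /= en; rewrite mem_set//=; congr EFin.
  rewrite /f /Num.min; case: ltP => // h.
  apply/eqP; rewrite eq_le h /=.
  apply: le_trans (_ : n.+1%:R * e <= _); last by rewrite ler_pM2l.
  rewrite -ler_pdivrMr// mul1r; apply: ltW; apply: lt_le_trans (truncnS_gt _) _.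
  by rewrite ler_nat.
have mf n : measurable_fun (K : set BMat) ((fun x => (f n x)%:E) : BMat -> \bar R).
  by apply/measurable_EFinP; exact: (bounded_mfun_lip xi_smooth (fL n)).1.
apply: (@emeasurable_fun_cvg _ BProb R _ (fun n nu => (intK xi nu (f n))%:E)).
  move=> n; apply/measurable_EFinP; exact: (measurable_intK_lip (ltr0Sn _ _) (fL n)).
move=> nu Pnu.
have -> : (fun n => (intK xi nu (f n))%:E) = (fun n => \int[nu]_(x in K) (f n x)%:E)%E.
  apply/funext => n; rewrite /intK fineK//; apply: integrable_fin_num.
    exact: measurable_Kxi.
  exact: (intK_integrable xi_smooth nu (bounded_mfun_lip xi_smooth (fL n))).
rewrite /evalP Pup_setIK//.
have -> : nu (A `&` K) = (\int[nu]_(x in K) (limn (fun n => (f n x)%:E)))%E.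
  rewrite -integral_indic//; last exact: measurable_Kxi.
  by apply: eq_integral => x _; apply/esym/cvg_lim => //; exact: cvgf.
apply: cvg_monotone_convergence => //.
- exact: measurable_Kxi.
- by move=> n x _; rewrite lee_fin.
- move=> x _ m n mn; rewrite lee_fin /f le_min ge_min lexx /=.
  by rewrite ge_min ler_wpM2r ?orbT// ler_nat.
Qed.

Lemma frob_openI (A B : set (Mat R D)) : frob_open A -> frob_open B -> frob_open (A `&` B).
Proof.
move=> oA oB x [/oA[e [e0 eA]] /oB[d [d0 dB]]]; exists (Num.min e d).
split; first by rewrite lt_min e0.
by move=> y; rewrite lt_min => /andP[h1 h2]; split; [exact: eA|exact: dB].
Qed.

(** A pi-lambda argument starting from the open sets; it lets the members of [Pup] form a measurable
    kernel. *)
Lemma measurable_evalP (A : set BMat) : measurable A ->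
  measurable_fun (Pup xi : set BProb) ((fun nu => evalP nu A) : BProb -> \bar R).
Proof.
move=> mA; move: A mA; apply: (@dynkin_induction _ BMat (@frob_open R D)
  (fun A => measurable_fun (Pup xi : set BProb) ((fun nu => evalP nu A) : BProb -> \bar R))).
- by [].
- by move=> A B; exact: frob_openI.
- by apply: measurable_evalP_open => x _; exists 1.
- by move=> A; exact: measurable_evalP_open.
- move=> A mA pA.
  apply: (@eq_measurable_fun _ _ BProb (\bar R) _ (fun nu : BProb => 1 - evalP nu A)%E).
    by move=> nu _; rewrite /evalP; apply/esym; exact: probability_setC.
  by apply: emeasurable_funB => //; exact: measurable_cst.
- move=> F mF tF pF.
  apply: (@emeasurable_fun_cvg _ BProb R _ (fun n nu => \sum_(0 <= i < n) evalP nu (F i))%E).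
    by move=> n; apply: emeasurable_sum => i; exact: pF.
  by move=> nu _; exact: measure_sigma_additive.
Qed.

End MeasurabilityOnPup.

(** * Barycenters and weak duality *)

Section Barycenter.
Variables (R : realType) (D : nat) (xi : 'M[R]_D -> R).
Hypothesis xi_smooth : smooth xi.
Local Notation K := (Kxi xi).
Local Notation BMat := (g_sigma_algebraType (@frob_open R D)).
Local Notation BProb := (g_sigma_algebraType (@Pup_open R D xi)).

Lemma eta_Pup (eta : probability BProb R) : eta_on_Pup eta -> eta (Pup xi) = 1%E.
Proof.
move=> eP; have mP := @measurable_Pup R D xi.
have := probability_setC eta (measurableC mP); rewrite setCK => ->.
by rewrite [X in (_ - X)%E](_ : _ = 0%E) ?sube0.
Qed.

(** Evaluations are known to be measurable on [Pup] only. The zero subprobability outside gives a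
    kernel on the whole space and leaves integrals over [Pup] unchanged. *)
Definition kernel_on_Pup (nu : BProb) : giry BMat R :=
  if nu \in (Pup xi : set BProb) then
    ((nu : probability BMat R) : subprobability BMat R)
  else (@mzero _ BMat R : subprobability BMat R).

Lemma measurable_kernel_on_Pup : measurable_fun setT kernel_on_Pup.
Proof.
have mP := @measurable_Pup R D xi.
apply: measurable_giry_codensity => // B mB.
rewrite -(setUv (Pup xi)); apply/measurable_funU => //; first exact: measurableC.
split.
  apply: (@eq_measurable_fun _ _ BProb (\bar R) _ (fun nu => evalP nu B)).
    by move=> nu nP; rewrite /kernel_on_Pup nP.
  exact: measurable_evalP.
apply: (@eq_measurable_fun _ _ BProb (\bar R) _ (fun=> 0%E)); last exact: measurable_cst.
by move=> nu /set_mem nP; rewrite /kernel_on_Pup memNset.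
Qed.

(** The barycenter is the Giry bind of [eta] with the kernel above: the two agree on measurable
    sets, and integration against a bind is an iterated integral. *)
Lemma Bar_integral (eta : probability BProb R) (beta : Prob R D) (h : BMat -> \bar R) :
  is_Bar eta beta -> measurable_fun setT h -> (forall x, 0 <= h x)%E ->
  (\int[beta]_x h x = \int[eta]_(nu in (Pup xi : set BProb)) \int[(nu : probability BMat R)]_x h x)%E.
Proof.
move=> Bar mh h0; have mk := measurable_kernel_on_Pup.
have kE (f : giry BMat R -> \bar R) : f mzero = 0%E ->
    (\int[eta]_nu f (kernel_on_Pup nu) =
     \int[eta]_(nu in (Pup xi : set BProb)) f (nu : probability BMat R))%E.
  move=> f0; rewrite [RHS]integral_mkcond; apply: eq_integral => nu _.
  by rewrite /kernel_on_Pup patchE; case: ifP.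
have H := @giry_int_bind _ _ BProb BMat R (eta : subprobability _ _) _ mk h mh h0.
transitivity (giry_int (giry_bind (eta : subprobability _ _) mk) h).
  apply: eq_measure_integral => A mA _.
  apply: (eq_trans (Bar A mA)).
  apply: (eq_trans (esym (kE (fun m => giry_ev m A) erefl))).
  have mA' := @measurable_giry_ev _ BMat R A mA.
  by rewrite /giry_bind /= /giry_join /= giry_int_map.
apply: (eq_trans H).
by apply: (kE (fun m => \int[m]_x h x)%E); exact: integral_measure_zero.
Qed.

Lemma Bar_K (eta : probability BProb R) (beta : Prob R D) :
  eta_on_Pup eta -> is_Bar eta beta -> beta K = 1%E.
Proof.
move=> eP Bar; rewrite (Bar _ (measurable_Kxi xi_smooth)).
rewrite (eq_integral (fun=> 1%E)); last first.
  by move=> nu /set_mem Pnu; rewrite /evalP Pup_K.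
rewrite integral_cst; last exact: measurable_Pup.
by rewrite mul1e; exact: eta_Pup.
Qed.

Lemma integrable_intK (eta : probability BProb R) chi : Lle1 xi chi ->
  eta.-integrable (Pup xi : set BProb) (EFin \o (fun nu : BProb => intK xi nu chi)).
Proof.
move=> L; have mP := @measurable_Pup R D xi.
apply: measurable_bounded_integrable => //.
- by rewrite ltey_eq fin_num_measure.
- have [chi' [chi'L chi'E]] := Lle1_extension xi_smooth L.
  apply: (@eq_measurable_fun _ _ BProb R _ (fun nu : BProb => intK xi nu chi')).
    by move=> nu _; apply: eq_intK => x /chi'E.
  by apply: (measurable_intK_lip xi_smooth (@ltr01 R)) => x y; rewrite mul1r.
- have [C [_ CP]] := intK_bounded xi_smooth.
  exists C; split; first exact: num_real.
  by move=> M CM nu _; apply: le_trans (CP nu chi L) (ltW CM).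
Qed.

Lemma intK_Bar (eta : probability BProb R) (beta : Prob R D) chi :
  eta_on_Pup eta -> is_Bar eta beta -> Lle1 xi chi ->
  intK xi beta chi = Defs.intP eta (fun nu => intK xi nu chi).
Proof.
move=> eP Bar L; have mK := measurable_Kxi xi_smooth.
have mP := @measurable_Pup R D xi.
have [C [C0 CP]] := Lle1_bounded xi_smooth.
have bchi := bounded_mfun_Lle1 xi_smooth L.
(* [Bar_integral] treats non-negative integrands, hence the shift by the uniform bound [C]; it
   cancels at the end because all the masses are 1. *)
pose g := fun x : Mat R D => chi x + C.
have bg : bounded_mfun xi g by apply: bounded_mfunD => //; exact: bounded_mfun_cst.
pose h : BMat -> \bar R := (EFin \o g) \_ K.
have mh : measurable_fun setT h.
  by apply/(measurable_restrictT _ mK)/measurable_EFinP; exact: bg.1.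
have h0 x : (0 <= h x)%E.
  rewrite /h patchE; case: ifPn => // /set_mem Kx; rewrite /= lee_fin /g.
  by have := CP _ L x Kx; rewrite ler_norml => /andP[]; lra.
have hE (m : Prob R D) : (\int[m]_x h x = (intK xi m g)%:E)%E.
  rewrite /intK fineK; last first.
    by apply: integrable_fin_num => //; exact: (intK_integrable xi_smooth m bg).
  by rewrite [RHS]integral_mkcond.
have gE (m : Prob R D) : m K = 1%E -> intK xi m g = intK xi m chi + C.
  move=> mK1; rewrite intK_D//; last exact: bounded_mfun_cst.
  congr (_ + _); transitivity (C * fine (m K)); first exact: intK_cst.
  by rewrite mK1 mulr1.
have := Bar_integral Bar mh h0; rewrite hE gE; last exact: Bar_K eP Bar.
rewrite (eq_integral (fun nu : BProb => (intK xi nu chi + C)%:E)); last first.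
  by move=> nu /set_mem Pnu; rewrite hE gE ?Pup_K.
move=> /(congr1 fine) /=.
have eP1 := eta_Pup eP.
have fin : (eta (Pup xi) < +oo)%E by rewrite eP1 ltry.
have int1 := integrable_intK eta L.
have intC : eta.-integrable (Pup xi : set BProb) (EFin \o (fun=> C)).
  by apply: measurable_bounded_integrable => //; exact: bounded_cst.
have := RintegralD mP int1 intC; rewrite /Rintegral => ->.
have := Rintegral_cst eta mP C; rewrite /Rintegral => ->.
rewrite [fine (eta _)](_ : _ = 1); last by rewrite [X in fine X]eP1.
by rewrite mulr1 => /addIr.
Qed.

Section UpperBound.
Variables (phi : Prob R D -> R).
Hypothesis phi_lip : lip1_Pup xi phi.

Lemma Pup_inhabited : exists mu, Pup xi mu.
Proof.
exists (emp (grad xi \o (fun=> 0)) [:: 0%N]); apply: Pup_emp => //.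
split; first by move=> k; exact: psd_ball0.
by move=> i j _; rewrite subrr; exact: psd0.
Qed.

Lemma phi_bounded : exists B, forall mu, Pup xi mu -> `|phi mu| <= B.
Proof.
have [C [C0 bd]] := intK_bounded xi_smooth.
have [mu0 P0] := Pup_inhabited; exists (`|phi mu0| + 2 * C) => mu Pmu.
have h : dP xi mu mu0 <= 2 * C.
  apply: distM_le => chi L; rewrite /embed.
  have := bd mu chi L; have := bd mu0 chi L; rewrite !ler_norml => /andP[? ?] /andP[? ?]; lra.
have := phi_lip Pmu P0; have := ler_normD (phi mu - phi mu0) (phi mu0); rewrite subrK.
move: (dP _ _ _) h => a h; lra.
Qed.

Lemma phi_integrable (eta : probability BProb R) :
  eta.-integrable (Pup xi : set BProb) (EFin \o (phi : BProb -> R)).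
Proof.
have mP := @measurable_Pup R D xi; have [B BP] := phi_bounded.
apply: measurable_bounded_integrable => //.
- by rewrite ltey_eq fin_num_measure.
- by apply: (measurable_dP_lip xi_smooth (L := 1)) => mu nu Pmu Pnu; rewrite mul1r; exact: phi_lip.
- exists B; split; first exact: num_real.
  by move=> M BM mu /BP h; apply: le_trans h (ltW BM).
Qed.

Lemma phistar_le chi mu : Lle1 xi chi -> Pup xi mu ->
  phistar xi phi chi <= intK xi mu chi - phi mu.
Proof.
move=> L Pmu; apply: ge_inf; last by exists mu.
have [C [C0 CP]] := intK_bounded xi_smooth; have [B BP] := phi_bounded.
exists (- C - B) => _ [nu [Pnu ->]].
have := CP nu chi L; have := BP nu Pnu; rewrite !ler_norml => /andP[? ?] /andP[? ?]; lra.
Qed.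

(** Weak duality: [chi] tests the distance from below, [intK_Bar] turns the barycenter into an
    integral over [eta], and [phistar] bounds the integrand pointwise. *)
Lemma phibar_set_le (F : (Mat R D -> R) -> R) chi r : Lle1_bounded_functional xi F ->
  Lle1 xi chi -> phibar_set xi phi F r -> r <= F chi - phistar xi phi chi.
Proof.
move=> bF L [eta [beta [eP [Bar ->]]]].
have h1 := distM_ge (embed_bounded xi_smooth beta) bF L.
suff h2 : Defs.intP eta phi <= intK xi beta chi - phistar xi phi chi.
  by move: h1; rewrite /embed; lra.
have mP := @measurable_Pup R D xi.
rewrite (intK_Bar eP Bar L) -[leRHS]/(_ - _).
have int1 := integrable_intK eta L.
have intC : eta.-integrable (Pup xi : set BProb) (EFin \o (fun=> phistar xi phi chi)).
  by apply: measurable_bounded_integrable => //; rewrite ?ltey_eq ?fin_num_measure//; exact: bounded_cst.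
have E : Rintegral eta (Pup xi : set BProb) (fun nu : BProb => intK xi nu chi - phistar xi phi chi) =
    Defs.intP eta (fun nu => intK xi nu chi) - phistar xi phi chi.
  rewrite RintegralB// Rintegral_cst//; congr (_ - _).
  by rewrite [fine _](_ : _ = 1) ?mulr1// [X in fine X](eta_Pup eP).
rewrite -E; apply: le_Rintegral => //.
- exact: phi_integrable.
- by apply: eq_integrable (integrableB mP int1 intC) => // nu _; rewrite /= EFinB.
- by move=> nu Pnu; have := phistar_le L Pnu; lra.
Qed.

End UpperBound.
End Barycenter.

(** * Strong duality *)

Section Duality.
Variables (R : realType) (D : nat) (xi : 'M[R]_D -> R).
Hypothesis xi_smooth : smooth xi.
Local Notation K := (Kxi xi).
Local Notation BMat := (g_sigma_algebraType (@frob_open R D)).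
Local Notation BProb := (g_sigma_algebraType (@Pup_open R D xi)).
Implicit Types F G : (Mat R D -> R) -> R.

Definition mix (t : R) (f g : Mat R D -> R) : Mat R D -> R := fun x => t * f x + (1 - t) * g x.

(** What the duality argument uses of an element of the completion. These properties also hold for
    [embed] of a law and pass to convex combinations, so neither has to be approximated by signed
    measures. *)
Definition Lle1_regular F := [/\ Lle1_bounded_functional xi F,
  (forall t f g, 0 <= t <= 1 -> Lle1 xi f -> Lle1 xi g ->
     F (mix t f g) = t * F f + (1 - t) * F g) &
  (forall e : R, 0 < e -> exists d : R, 0 < d /\ forall f g, Lle1 xi f -> Lle1 xi g ->
     (forall x, K x -> `|f x - g x| <= d) -> `|F f - F g| <= e)].

Lemma intK_mix (mu : {finite_measure set BMat -> \bar R}) t f g : Lle1 xi f -> Lle1 xi g ->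
  intK xi mu (mix t f g) = t * intK xi mu f + (1 - t) * intK xi mu g.
Proof.
move=> Lf Lg; have bf := bounded_mfun_Lle1 xi_smooth Lf; have bg := bounded_mfun_Lle1 xi_smooth Lg.
by rewrite /mix intK_D// ?intK_Z//; exact: bounded_mfunZ.
Qed.

Lemma embed_regular (mu : Prob R D) : Lle1_regular (embed xi mu).
Proof.
split; first exact: embed_bounded.
  by move=> t f g _ Lf Lg; exact: (intK_mix mu).
move=> e e0; exists e; split=> // f g Lf Lg fg.
by apply: (intK_dist_prob xi_smooth) => //; [exact: bounded_mfun_Lle1|exact: bounded_mfun_Lle1|exact: ltW].
Qed.

(** Serves as a Lipschitz constant of [intS] for the uniform distance on [K]. The two parts of [nu]
    may overlap, so it only bounds the total variation on [K]. *)
Definition mass (nu : Defs.signed R D) := fine (spos nu K) + fine (sneg nu K).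

Lemma mass_ge0 (nu : Defs.signed R D) : 0 <= mass nu.
Proof. by rewrite addr_ge0// fine_ge0. Qed.

Lemma intS_dist (nu : Defs.signed R D) f g (d : R) : Lle1 xi f -> Lle1 xi g ->
  (forall x, K x -> `|f x - g x| <= d) -> `|Defs.intS xi nu f - Defs.intS xi nu g| <= d * mass nu.
Proof.
move=> Lf Lg fg; have bf := bounded_mfun_Lle1 xi_smooth Lf; have bg := bounded_mfun_Lle1 xi_smooth Lg.
have h1 := intK_dist xi_smooth (spos nu) bf bg fg.
have h2 := intK_dist xi_smooth (sneg nu) bf bg fg.
rewrite /Defs.intS /mass mulrDr.
have alg (a b c d' : R) : a - b - (c - d') = (a - c) - (b - d') by ring.
by rewrite alg; apply: le_trans (ler_normB _ _) _; exact: lerD.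
Qed.

Lemma intS_mix (nu : Defs.signed R D) t f g : Lle1 xi f -> Lle1 xi g ->
  Defs.intS xi nu (mix t f g) = t * Defs.intS xi nu f + (1 - t) * Defs.intS xi nu g.
Proof. by move=> Lf Lg; rewrite /Defs.intS !intK_mix//; ring. Qed.

Lemma intS_0 (nu : Defs.signed R D) : Defs.intS xi nu (fun=> 0) = 0.
Proof. by rewrite /Defs.intS !intK_cst// !mul0r subrr. Qed.

Lemma Lle1_0 : Lle1 xi (fun=> 0).
Proof. by apply: Lle1_cst; rewrite normr0. Qed.

(** Each property holds for a signed measure and survives uniform approximation on the unit ball;
    the modulus [d] depends on the mass of the approximating measure. *)
Lemma inM1_regular F : inM1 xi F -> Lle1_regular F.
Proof.
move=> HF; split.
- have [nu [_ nuP]] := HF 1 ltr01; have [C [C0 CP]] := Lle1_bounded xi_smooth.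
  exists (1 + C * mass nu) => f Lf.
  have h1 := nuP f Lf.
  have h2 : `|Defs.intS xi nu f - Defs.intS xi nu (fun=> 0)| <= C * mass nu.
    by apply: intS_dist => //; [exact: Lle1_0|move=> x Kx; rewrite subr0; exact: CP].
  rewrite intS_0 subr0 in h2.
  by have := ler_normD (F f - Defs.intS xi nu f) (Defs.intS xi nu f); rewrite subrK; lra.
- move=> t f g t01 Lf Lg; apply/eqP; rewrite -subr_eq0 -normr_le0.
  apply/ler_addgt0Pl => e e0; rewrite addr0.
  have e2 : 0 < e / 2 by lra.
  have [nu [_ nuP]] := HF _ e2.
  have h1 := nuP _ (Lle1_comb t01 Lf Lg); rewrite -/(mix t f g) intS_mix// in h1.
  have h2 := nuP f Lf; have h3 := nuP g Lg; case/andP: t01 => t0 t1.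
  have h2' : `|t * (F f - Defs.intS xi nu f)| <= t * (e / 2) by rewrite normrM ger0_norm// ler_wpM2l.
  have u0 : 0 <= 1 - t by lra.
  have h3' : `|(1 - t) * (F g - Defs.intS xi nu g)| <= (1 - t) * (e / 2).
    by rewrite normrM (ger0_norm u0) ler_wpM2l.
  move: h1 h2' h3'; rewrite !ler_norml => /andP[? ?] /andP[? ?] /andP[? ?].
  by apply/andP; split; lra.
- move=> e e0; have e3 : 0 < e / 3 by lra.
  have [nu [_ nuP]] := HF _ e3; have m0 := mass_ge0 nu.
  have m1 : 0 < mass nu + 1 by lra.
  exists (e / 3 / (mass nu + 1)); split; first by rewrite divr_gt0.
  move=> f g Lf Lg fg; have h1 := nuP f Lf; have h2 := nuP g Lg.
  have h3 := intS_dist nu Lf Lg fg.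
  have h4 : e / 3 / (mass nu + 1) * mass nu <= e / 3.
    by rewrite mulrAC ler_pdivrMr// ler_pM2l//; lra.
  have := le_trans h3 h4; move: h1 h2; rewrite !ler_norml => /andP[? ?] /andP[? ?] /andP[? ?].
  by apply/andP; split; lra.
Qed.

Lemma Lle1N f : Lle1 xi f -> Lle1 xi (fun x => - f x).
Proof.
move=> [f0 fl]; split; first by rewrite normrN.
by move=> x y Kx Ky; rewrite -opprD normrN; exact: fl.
Qed.

(** Affinity at the midpoint of [f] and its opposite, where [F] vanishes. It makes [distM]
    symmetric, as that supremum carries no absolute value. *)
Lemma inM1_odd F f : inM1 xi F -> Lle1 xi f -> F (fun x => - f x) = - F f.
Proof.
move=> HF Lf; have Lnf := Lle1N Lf.
have F0 : F (fun=> 0) = 0.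
  apply/eqP; rewrite -normr_le0; apply/ler_addgt0Pl => e e0; rewrite addr0.
  have [nu [_ nuP]] := HF e e0.
  by have := nuP _ Lle1_0; rewrite intS_0 subr0.
have [_ aff _] := inM1_regular HF.
have h01 : 0 <= (2^-1 : R) <= 1 by rewrite invr_ge0 ler0n invf_le1// ler1n.
have := aff 2^-1 f (fun x => - f x) h01 Lf Lnf.
rewrite [mix _ _ _](_ : _ = (fun=> 0)) ?F0 => [h|]; first lra.
by apply/funext => x; rewrite /mix; lra.
Qed.

Section Phi.
Variables (phi : Prob R D -> R).
Hypothesis phi_lip : lip1_Pup xi phi.

(** The witness [eta] is the uniform law on the points [nu i] of [Pup]; its barycenter is their
    average as measures on matrices. *)
Lemma discrete_in_phibar_set F M (nu : 'I_M.+1 -> Prob R D) : (forall i, Pup xi (nu i)) ->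
  phibar_set xi phi F (M.+1%:R^-1 * \sum_i phi (nu i) - distM xi (embed xi (avg nu)) F).
Proof.
move=> Pnu; have mP := @measurable_Pup R D xi.
pose dnu i := @dirac _ BProb (nu i) R : probability BProb R.
pose eta : probability BProb R := pavg dnu.
have etaE (f : Prob R D -> R) (C : R) :
    measurable_fun (Pup xi : set BProb) (f : BProb -> R) ->
    (forall m, Pup xi m -> `|f m| <= C) ->
    Defs.intP eta f = M.+1%:R^-1 * \sum_i f (nu i).
  move=> mf fC; rewrite /Defs.intP Rintegral_pavg//; last by exists C.
  congr (_ * _); apply: eq_bigr => i _; rewrite integral_dirac//; last exact/measurable_EFinP.
  by rewrite diracE mem_set// mul1e.
exists eta, (avg nu); split; [|split].
- rewrite /eta_on_Pup -[LHS]/(pavg dnu _) pavgE big1 ?mule0// => i _.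
  rewrite /dnu [LHS]diracE memNset//; exact.
- move=> A mA.
  have fev (m : Prob R D) : (evalP m A = (fine (evalP m A))%:E)%E.
    by rewrite fineK// /evalP fin_num_measure.
  have mfin : measurable_fun (Pup xi : set BProb) ((fun m : Prob R D => fine (evalP m A)) : BProb -> R).
    apply/measurable_EFinP; apply: (@eq_measurable_fun _ _ BProb (\bar R) _ (fun m => evalP m A)).
      by move=> m _; rewrite /= -fev.
    exact: measurable_evalP.
  have bfin (m : Prob R D) : Pup xi m -> `|fine (evalP m A)| <= 1.
    move=> _; rewrite ger0_norm; last by rewrite fine_ge0.
    by rewrite -lee_fin -fev /evalP; exact: probability_le1.
  rewrite (eq_integral (fun m : BProb => (fine (evalP m A))%:E)) => [|m _]; last exact: fev.
  rewrite -[RHS]fineK.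
    have := etaE _ 1 mfin bfin; rewrite /Defs.intP => ->.
    rewrite /avg -[LHS]/(pavg nu A) pavgE EFinM; congr (_ * _)%E.
    by rewrite -sumEFin; apply: eq_bigr => i _; exact: fev.
  apply: integrable_fin_num => //; apply: measurable_bounded_integrable => //.
    by rewrite ltey_eq fin_num_measure.
  exists 1; split; first exact: num_real.
  by move=> B B1 m Pm; apply: le_trans (bfin m Pm) (ltW B1).
- have [B BP] := phi_bounded xi_smooth phi_lip.
  rewrite (etaE phi B)//.
  by apply: (measurable_dP_lip xi_smooth (L := 1)) => m m' Pm Pm'; rewrite mul1r; exact: phi_lip.
Qed.

Lemma phistar_dist f g (d : R) : Lle1 xi f -> Lle1 xi g -> 0 <= d ->
  (forall x, K x -> `|f x - g x| <= d) -> phistar xi phi f <= phistar xi phi g + d.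
Proof.
move=> Lf Lg d0 fg; rewrite -lerBlDr; apply: lb_le_inf.
  by have [mu Pmu] := Pup_inhabited xi_smooth; exists (intK xi mu g - phi mu), mu.
move=> _ [mu [Pmu ->]]; have h := phistar_le xi_smooth phi_lip Lf Pmu.
have := intK_dist_prob xi_smooth mu (bounded_mfun_Lle1 xi_smooth Lf)
  (bounded_mfun_Lle1 xi_smooth Lg) d0 fg.
by rewrite ler_norml => /andP[_ h2]; lra.
Qed.

Lemma dual_minimizer F : Lle1_regular F -> exists chi0, Lle1 xi chi0 /\
  forall chi, Lle1 xi chi -> F chi0 - phistar xi phi chi0 <= F chi - phistar xi phi chi.
Proof.
move=> [[B FB] _ Fc]; pose G chi := F chi - phistar xi phi chi.
pose S := [set r | exists chi, Lle1 xi chi /\ r = G chi].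
have [C [C0 CP]] := intK_bounded xi_smooth.
have [mu0 P0] := Pup_inhabited xi_smooth.
have hS : has_inf S.
  split; first by exists (G (fun=> 0)), (fun=> 0); split=> //; exact: Lle1_0.
  exists (- B - C + phi mu0) => _ [chi [L ->]]; rewrite /G.
  have := phistar_le xi_smooth phi_lip L P0; have := CP mu0 chi L; have := FB chi L.
  rewrite !ler_norml => /andP[? ?] /andP[? ?] ?; lra.
have /choice[u uP] (n : nat) : exists chi, Lle1 xi chi /\ G chi < inf S + n.+1%:R^-1.
  have n0 : 0 < n.+1%:R^-1 :> R by rewrite invr_gt0.
  by have [_ [chi [L ->]] h] := inf_adherent n0 hS; exists chi.
have [chi0 [L0 cl]] := Lle1_cluster xi_smooth (fun n => (uP n).1).
exists chi0; split=> // chi L; rewrite -/(G chi0) -/(G chi).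
apply: le_trans (_ : inf S <= _); last by apply: ge_inf; [case: hS|exists chi].
apply/ler_addgt0Pl => e e0; have e3 : 0 < e / 3 by lra.
have [d [d0 dP]] := Fc _ e3.
(* [d] serves the continuity of [F], and [e / 3] that of [phistar], which is 1-Lipschitz for the
   uniform norm on [K]. *)
have m0 : 0 < Num.min d (e / 3) by rewrite lt_min d0.
have [n Nn h] := cl _ (Num.truncn (3 / e)) m0.
have n3 : n.+1%:R^-1 <= e / 3.
  rewrite -[e / 3]invrK lef_pV2 ?posrE ?invr_gt0 ?ltr0Sn// invf_div.
  by apply: le_trans (ltW (truncnS_gt _)) _; rewrite ler_nat.
have [Ln Gn] := uP n.
have hF : `|F (u n) - F chi0| <= e / 3.
  by apply: dP => // x Kx; apply: le_trans (h x Kx) _; rewrite ge_min lexx.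
have hp : phistar xi phi (u n) <= phistar xi phi chi0 + e / 3.
  apply: phistar_dist => //; first exact: ltW.
  by move=> x Kx; apply: le_trans (h x Kx) _; rewrite ge_min lexx orbT.
move: hF; rewrite ler_norml => /andP[hF1 hF2]; move: Gn; rewrite /G.
move: (inf S) (n.+1%:R^-1) n3 => i k n3 Gn {Nn cl}; lra.
Qed.

(** A net of the unit ball, with a near-minimizer in [phistar] for each net point, gives finitely
    many laws, one of which answers any given [chi]. The minimax theorem replaces them by one
    average that answers all [chi] at once, hence also the supremum in [distM]. *)
Lemma dual_approx F V (e : R) : Lle1_regular F -> 0 < e ->
  (forall chi, Lle1 xi chi -> V <= F chi - phistar xi phi chi) ->
  exists M (nu : 'I_M.+1 -> Prob R D), (forall i, Pup xi (nu i)) /\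
    V - e <= M.+1%:R^-1 * \sum_i phi (nu i) - distM xi (embed xi (avg nu)) F.
Proof.
move=> [[B FB] Faff Fc] e0 HV; have e4 : 0 < e / 4 by lra.
have [d [d0 dP]] := Fc _ e4.
have m0 : 0 < Num.min d (e / 4) by rewrite lt_min d0.
have [n [f [fL fP]]] := Lle1_net xi_smooth m0.
have [C [C0 CP]] := intK_bounded xi_smooth.
have [Bp phiB] := phi_bounded xi_smooth phi_lip.
have [mu0 P0] := Pup_inhabited xi_smooth.
have /choice[nu nuP] (j : 'I_n) : exists mu, Pup xi mu /\
    V - e / 4 <= phi mu - intK xi mu (f j) + F (f j).
  have hS : has_inf [set r | exists mu, Pup xi mu /\ r = intK xi mu (f j) - phi mu].
    split; first by exists (intK xi mu0 (f j) - phi mu0), mu0.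
    exists (- C - Bp) => _ [mu [Pmu ->]].
    have := CP mu _ (fL j); have := phiB mu Pmu; rewrite !ler_norml => /andP[? ?] /andP[? ?]; lra.
  have [_ [mu [Pmu ->]] h] := inf_adherent e4 hS; exists mu; split=> //.
  by have := HV _ (fL j); rewrite /phistar; move: (inf _) h => i h ?; lra.
pose g j chi := phi (nu j) - intK xi (nu j) chi + F chi.
have gE j chi : g j chi = phi (nu j) - intK xi (nu j) chi + F chi by [].
(* Of the three quarters of [e], one is the near-minimality of [nu j] and two come from replacing
   [f j] by [chi] in [F] and in the integral; the last quarter is the loss of the minimax
   theorem. *)
have [|||||l l0 lP] := @list_minimax R _ 'I_n mix g (Bp + C + B) (enum 'I_n)
    (Lle1 xi) (V - 3 * (e / 4)) _ _ _ _ _ _ e4.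
- by move=> t h k t01 Lh Lk; exact: Lle1_comb.
- move=> j t h k t01 Lh Lk; rewrite !gE Faff// (intK_mix (nu j))//; ring.
- move=> j chi L; rewrite gE.
  have := CP (nu j) _ L; have := phiB _ (nuP j).1; have := FB _ L.
  by rewrite !ler_norml => /andP[? ?] /andP[? ?] /andP[? ?]; apply/andP; split; lra.
- move=> chi L; have [j jP] := fP chi L; exists j; first by rewrite mem_enum.
  have h1 : `|F chi - F (f j)| <= e / 4.
    by apply: dP => // x Kx; apply: le_trans (jP x Kx) _; rewrite ge_min lexx.
  have h2 : `|intK xi (nu j) chi - intK xi (nu j) (f j)| <= e / 4.
    apply: (intK_dist_prob xi_smooth); [exact: bounded_mfun_Lle1|exact: bounded_mfun_Lle1|exact: ltW|].
    by move=> x Kx; apply: le_trans (jP x Kx) _; rewrite ge_min lexx orbT.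
  have := (nuP j).2; move: h1 h2; rewrite gE !ler_norml => /andP[? ?] /andP[? ?] ?; lra.
- by exists (fun=> 0); exact: Lle1_0.
have j0 : 'I_n by case: l l0 {lP}.
have sl : 0 < (size l)%:R :> R by rewrite ltr0n.
exists (size l).-1, (fun i => nu (nth j0 l i)); split; first by move=> i; exact: (nuP _).1.
have sumE (h : 'I_n -> R) : \sum_(i < (size l).-1.+1) h (nth j0 l i) = \sum_(j <- l) h j.
  by rewrite prednK// (big_nth j0) big_mkord.
rewrite lerBrDr addrC -lerBrDr; apply: distM_le => chi L.
rewrite /embed (intK_avg xi_smooth); last exact: bounded_mfun_Lle1.
rewrite (sumE (fun j => phi (nu j))) (sumE (fun j => intK xi (nu j) chi)).
have -> : (size l).-1.+1%:R = (size l)%:R :> R by rewrite prednK.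
have := lP chi L; rewrite /g big_split sumrB /= big_const_seq count_predT iter_addr_0.
rewrite -[F chi *+ _]mulr_natl; move: (\sum_(j <- l) phi _) (\sum_(j <- l) intK _ _ _) => a b h.
have {}h : V - e <= (size l)%:R^-1 * (a - b + (size l)%:R * F chi).
  rewrite ler_pdivlMl// mulrC; apply: le_trans h; rewrite ler_pM2r//; lra.
move: h; rewrite mulrDr mulKf ?gt_eqF// mulrBr; lra.
Qed.

Lemma phibar_dual F chi0 : Lle1_regular F -> Lle1 xi chi0 ->
  (forall chi, Lle1 xi chi -> F chi0 - phistar xi phi chi0 <= F chi - phistar xi phi chi) ->
  phibar xi phi F = F chi0 - phistar xi phi chi0.
Proof.
move=> Freg L0 min0; have [Fb _ _] := Freg.
have ub : ubound (phibar_set xi phi F) (F chi0 - phistar xi phi chi0).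
  by move=> r; exact: (phibar_set_le xi_smooth phi_lip Fb L0).
apply/eqP; rewrite eq_le; apply/andP; split.
  apply: ge_sup => //; have [mu Pmu] := Pup_inhabited xi_smooth.
  by eexists; apply: (@discrete_in_phibar_set F 0 (fun=> mu)).
apply/ler_addgt0Pl => e e0; rewrite -lerBlDl.
have [M [nu [Pnu h]]] := dual_approx Freg e0 min0.
apply: le_trans h _; apply: ub_le_sup; first by eexists; exact: ub.
exact: discrete_in_phibar_set.
Qed.

End Phi.
End Duality.

Theorem theorem5p12 (R : realType) (D : nat) (xi : 'M[R]_D -> R) :
  smooth xi -> strictly_convex_psd xi ->
  forall phi : Prob R D -> R, lip1_Pup xi phi -> preconcave xi phi ->
  [/\ (* phibar is real-valued on M_1(K_xi) *)
      (forall F, inM1 xi F -> has_ubound (phibar_set xi phi F)),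
      (* phibar is 1-Lipschitz *)
      (forall F G, inM1 xi F -> inM1 xi G ->
         `|phibar xi phi F - phibar xi phi G| <= distM xi F G),
      (* phibar is concave *)
      (forall F G (l : R), inM1 xi F -> inM1 xi G -> 0 <= l <= 1 ->
         l * phibar xi phi F + (1 - l) * phibar xi phi G
           <= phibar xi phi (fun chi => l * F chi + (1 - l) * G chi)),
      (* phibar extends phi *)
      (forall mu, Pup xi mu -> phibar xi phi (embed xi mu) = phi mu) &
      (* dual (min) formula *)
      (forall F, inM1 xi F -> exists chi0 : Mat R D -> R,
         [/\ Lle1 xi chi0,
             phibar xi phi F = F chi0 - phistar xi phi chi0 &
             forall chi, Lle1 xi chi ->
               phibar xi phi F <= F chi - phistar xi phi chi])].
Proof.
move=> xi_smooth _ phi phi_lip phi_pre.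
have dual F : Lle1_regular xi F -> exists chi0, [/\ Lle1 xi chi0,
    phibar xi phi F = F chi0 - phistar xi phi chi0 &
    forall chi, Lle1 xi chi -> phibar xi phi F <= F chi - phistar xi phi chi].
  move=> Freg; have [chi0 [L0 min0]] := dual_minimizer xi_smooth phi_lip Freg.
  have E := phibar_dual xi_smooth phi_lip Freg L0 min0.
  by exists chi0; split=> // chi L; rewrite E; exact: min0.
have reg F : inM1 xi F -> Lle1_regular xi F by exact: inM1_regular.
split.
- move=> F /reg[Fb _ _]; exists (F (fun=> 0) - phistar xi phi (fun=> 0)) => r.
  exact: (phibar_set_le xi_smooth phi_lip Fb (Lle1_0 xi)).
(* The minimizer for [G] is a competitor for [F]. *)
- have half F G : inM1 xi F -> inM1 xi G -> phibar xi phi F - phibar xi phi G <= distM xi F G.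
    move=> HF HG; have [Fb _ _] := reg F HF; have [Gb _ _] := reg G HG.
    have [_ [_ _ leF]] := dual F (reg F HF); have [chi [L -> _]] := dual G (reg G HG).
    by have := leF chi L; have := distM_ge Fb Gb L; lra.
  have sym F G : inM1 xi F -> inM1 xi G -> distM xi G F <= distM xi F G.
    move=> HF HG; have [Fb _ _] := reg F HF; have [Gb _ _] := reg G HG.
    apply: distM_le => chi L; have := distM_ge Fb Gb (Lle1N L).
    by rewrite (inM1_odd xi_smooth HF L) (inM1_odd xi_smooth HG L); lra.
  move=> F G HF HG; rewrite ler_norml; apply/andP; split; last exact: half.
  by have := half G F HG HF; have := sym F G HF HG; lra.
- move=> F G l HF HG l01; have [Fb Fa Fc] := reg F HF; have [Gb Ga Gc] := reg G HG.
  case/andP: (l01) => l0 l1.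
  have l1' : 0 <= 1 - l by lra.
  have Hreg : Lle1_regular xi (fun chi => l * F chi + (1 - l) * G chi).
    have conv (a b c d : R) : `|a| <= c -> `|b| <= d -> `|l * a + (1 - l) * b| <= c + d.
      move=> ac bd; apply: le_trans (ler_normD _ _) _.
      rewrite !normrM (ger0_norm l0) (ger0_norm l1').
      by apply: lerD; [apply: le_trans ac|apply: le_trans bd]; rewrite ler_piMl//; lra.
    split.
    + have [B FB] := Fb; have [C GC] := Gb; exists (B + C) => chi L.
      by apply: conv; [exact: FB|exact: GC].
    + by move=> t f g t01 Lf Lg; rewrite Fa// Ga//; ring.
    + move=> e e0; have e2 : 0 < e / 2 by lra.
      have [d [d0 dP]] := Fc _ e2; have [d' [d'0 d'P]] := Gc _ e2.
      exists (Num.min d d'); split; first by rewrite lt_min d0.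
      move=> f g Lf Lg fg.
      rewrite [X in `|X|](_ : _ = l * (F f - F g) + (1 - l) * (G f - G g)); last by ring.
      rewrite [leRHS]splitr; apply: conv; [apply: dP|apply: d'P] => // x Kx;
        by apply: le_trans (fg x Kx) _; rewrite ge_min lexx ?orbT.
  (* An infimum of functions affine in the functional is concave: the minimizer for the combination
     is a competitor for both [F] and [G]. *)
  have [_ [_ _ leF]] := dual F (reg F HF); have [_ [_ _ leG]] := dual G (reg G HG).
  have [chi [L -> _]] := dual _ Hreg.
  have hF := ler_wpM2l l0 (leF chi L); have hG := ler_wpM2l l1' (leG chi L).
  by move: hF hG; move: (phistar _ _ _) (phibar _ _ _) (phibar _ _ _) => *; lra.
- move=> mu Pmu; have Freg := embed_regular xi_smooth mu.
  have [chi0 [L0 E le0]] := dual _ Freg.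
  apply/eqP; rewrite eq_le; apply/andP; split; last first.
    by rewrite E; have := phistar_le xi_smooth phi_lip L0 Pmu; rewrite /embed; lra.
  (* The value is approached by finite averages, for which Jensen's inequality absorbs exactly the
     distance that is subtracted. *)
  apply/ler_addgt0Pl => e e0; rewrite -lerBlDl.
  have [M [nu [Pnu h]]] := dual_approx xi_smooth phi_lip Freg e0 le0.
  apply: le_trans h _; rewrite lerBlDr.
  exact: (jensen_avg xi_smooth phi_lip phi_pre Pnu Pmu).
- by move=> F /reg/dual.
Qed.
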